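(* Let $\mathbb F$ be a field of characteristic $3$ and let $(\mathcal A,\mu)$ be an algebra in $\mathsf{Rep}\,\mathsf C_3$, with $\mu(x\otimes y)=xy$ for all $x,y$. Pick a splitting $\mathcal A=\mathcal A_0\oplus\mathcal A_1\oplus\mathcal A_2$, with $\mathcal A_i$ a direct sum of copies of $V_i$ for $i=0,1,2$, and a refinement $\mathcal A=A_{\bar0}\oplus A_{\bar1}\oplus\delta(A_{\bar1})\oplus\mathcal A_2$, where $\delta=\sigma-\mathrm{id}$, $A_{\bar0}=\mathcal A_0$ and $\mathcal A_1=A_{\bar1}\oplus\delta(A_{\bar1})$. Define a multiplication $m(x\otimes y)=x\bullet y$ on the vector superspace $A=A_{\bar0}\oplus A_{\bar1}$ by $$x_{\bar0}\bullet y_{\bar0}=\mathrm{proj}_{A_{\bar0}}(x_{\bar0}y_{\bar0}),\quad x_{\bar0}\bullet y_{\bar1}=\mathrm{proj}_{A_{\bar1}}(x_{\bar0}y_{\bar1}),\quad x_{\bar1}\bullet y_{\bar0}=\mathrm{proj}_{A_{\bar1}}(x_{\bar1}y_{\bar0}),\quad x_{\bar1}\bullet y_{\bar1}=\mathrm{proj}_{A_{\bar0}}\bigl(x_{\bar1}\delta(y_{\bar1})\bigr)$$ for $x_{\bar0},y_{\bar0}\in A_{\bar0}$, $x_{\bar1},y_{\bar1}\in A_{\bar1}$, with projections relative to $\mathcal A=A_{\bar0}\oplus A_{\bar1}\oplus\delta(A_{\bar1})\oplus\mathcal A_2$. Then the algebras $(\mathcal A,[\mu])$ and $\bigl(F(A),F(m)\circ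 J_{A,A}\bigr)$ in $\mathsf{Ver}_3$ are isomorphic.
   Context: All vector spaces are finite-dimensional over $\mathbb F$; tensor products are over $\mathbb F$. An algebra in a monoidal category is an object $\mathcal A$ with a morphism $\mathcal A\otimes\mathcal A\to\mathcal A$ (no associativity or unit is assumed). $\mathsf C_3$ is the cyclic group of order $3$ with a fixed generator $\sigma$. $\mathsf{Rep}\,\mathsf C_3$ is the symmetric tensor category of finite-dimensional representations of $\mathsf C_3$ over $\mathbb F$ (equivariant linear maps, usual tensor product, swap as braiding). Its indecomposable objects are, up to isomorphism, $V_0=\mathbb F$ (trivial), $V_1=\mathbb Fv_0\oplus\mathbb Fv_1$ with $\sigma(v_0)=v_0+v_1$, $\sigma(v_1)=v_1$, and $V_2=\mathbb Fw_0\oplus\mathbb Fw_1\oplus\mathbb Fw_2$ with $\sigma(w_0)=w_0+w_1$, $\sigma(w_1)=w_1+w_2$, $\sigma(w_2)=w_2$. A morphism $f:X\to Y$ in $\mathsf{Rep}\,\mathsf C_3$ is negligible if $\operatorname{tr}(fg)=0$ for all morphisms $g:Y\to X$. $\mathsf{Ver}_3$ is the symmetric tensor category with the same objects and tensor product as $\mathsf{Rep}\,\mathsf C_3$, with $\operatorname{Hom}_{\mathsf{Ver}_3}(X,Y)=\operatorname{Hom}_{\mathsf{Rep}\,\mathsf C_3}(X,Y)/\{\text{negligible morphisms}\}$, and with braiding the class of the swap; $[f]$ denotes the class of $f$. $\mathsf{sVec}$ is the category of vector superspaces $X=X_{\bar0}\oplus X_{\bar1}$ with parity-preserving linear maps $f=f_{\bar0}\oplus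 f_{\bar1}$. $F:\mathsf{sVec}\to\mathsf{Ver}_3$ is the functor $F(X)=X_{\bar0}\oplus(X_{\bar1}\otimes V_1)$ (with $\sigma$ acting trivially on $X_{\bar 0}$ and by $x_{\bar 1}\otimes v\mapsto x_{\bar 1}\otimes\sigma(v)$), $F(f)=[f_{\bar0}\oplus(f_{\bar1}\otimes\mathrm{id}_{V_1})]$. Its monoidal structure $J_{X,Y}:F(X)\otimes F(Y)\to F(X\otimes Y)$ is the class of the map $x_{\bar0}\otimes y_{\bar0}\mapsto x_{\bar0}\otimes y_{\bar0}$, $x_{\bar0}\otimes(y_{\bar1}\otimes v)\mapsto(x_{\bar0}\otimes y_{\bar1})\otimes v$, $(x_{\bar1}\otimes v)\otimes y_{\bar0}\mapsto(x_{\bar1}\otimes y_{\bar0})\otimes v$, $(x_{\bar1}\otimes u)\otimes(y_{\bar1}\otimes v)\mapsto\lambda(u\otimes v)\,x_{\bar1}\otimes y_{\bar1}$, where $\lambda:V_1\otimes V_1\to\mathbb F$ is given by $v_0\otimes v_1\mapsto1$, $v_1\otimes v_0\mapsto-1$, $v_0\otimes v_0,\,v_1\otimes v_1\mapsto0$. *)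

(* Defs.v *)
From HB Require Import structures.
From mathcomp Require Import all_boot all_order all_algebra.
From mathcomp Require Import boolp ring.

Set Implicit Arguments.
Unset Strict Implicit.
Unset Printing Implicit Defensive.

Import GRing.Theory passmx.
Local Open Scope ring_scope.

Section Linear.
Variable F : fieldType.
Implicit Types U V W Z : vectType F.

Definition lftr V (f : 'End(V)) : F :=
  \tr (mxof (vbasis {:V}) (vbasis {:V}) f).

Definition bilin U V W (b : U -> V -> W) : Prop :=
  (forall v, linear (b^~ v)) /\ (forall u, linear (b u)).

(* The tensor product is modelled on coordinates in fixed bases; it is used   *)
(* only through pure tensors and the universal property [tens_liftE],         *)
(* [tens_ext].                                                                *)
Definition tens U V : vectType F := 'M[F]_(\dim {:U}, \dim {:V}).

Definition tensv U V (u : U) (v : V) : tens U V :=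
  (rVof (vbasis {:U}) u)^T *m rVof (vbasis {:V}) v.

(* Meaningful only for bilinear [b]. *)
Definition tens_lift U V W (b : U -> V -> W) : 'Hom(tens U V, W) :=
  linfun (fun t : tens U V =>
    \sum_i \sum_j t i j *: b (vbasis {:U})`_i (vbasis {:V})`_j).

Lemma tens_lift_linear U V W (b : U -> V -> W) :
  linear (fun t : tens U V =>
    \sum_i \sum_j t i j *: b (vbasis {:U})`_i (vbasis {:V})`_j).
Proof.
move=> a s t; rewrite scaler_sumr -big_split; apply: eq_bigr => i _.
rewrite scaler_sumr -big_split; apply: eq_bigr => j _ /=.
by rewrite !mxE scalerDl scalerA.
Qed.

Lemma linfunE U V (f : U -> V) : linear f -> forall u, linfun f u = f u.
Proof.
move=> lf u; pose M := GRing.isLinear.Build F U V *:%R f lf.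
pose g : {linear U -> V} := HB.pack f M.
by rewrite (lfunE g).
Qed.

Lemma tens_lift_unfold U V W (b : U -> V -> W) t :
  tens_lift b t = \sum_i \sum_j t i j *: b (vbasis {:U})`_i (vbasis {:V})`_j.
Proof. exact: (linfunE (@tens_lift_linear U V W b)). Qed.

Lemma lin_sum U W (h : U -> W) : linear h -> forall n (a : 'I_n -> F) (x : 'I_n -> U),
  h (\sum_i a i *: x i) = \sum_i a i *: h (x i).
Proof.
move=> lh n a x.
have -> : h = linfun h by apply/funext => u; rewrite linfunE.
by rewrite linear_sum; apply: eq_bigr => i _; rewrite linearZ.
Qed.

Lemma tens_liftE U V W (b : U -> V -> W) : bilin b ->
  forall u v, tens_lift b (tensv u v) = b u v.
Proof.
case=> b1 b2 u v; rewrite tens_lift_unfold.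
rewrite [in RHS](coord_vbasis (memvf u)) (lin_sum (b1 v)).
apply: eq_bigr => i _; rewrite [in RHS](coord_vbasis (memvf v)).
rewrite (lin_sum (b2 _)) scaler_sumr; apply: eq_bigr => j _.
by rewrite mxE big_ord1 !mxE scalerA.
Qed.

Lemma tensv_bilin U V : bilin (@tensv U V).
Proof.
split=> [v a u u'|u a v v']; rewrite /tensv.
  by rewrite linearP /= linearP /= mulmxDl -scalemxAl.
by rewrite linearP /= mulmxDr -scalemxAr.
Qed.

Lemma tensv0 U V (u : U) : tensv u 0 = 0 :> tens U V.
Proof. by rewrite /tensv linear0 mulmx0. Qed.

Lemma tens0v U V (v : V) : tensv 0 v = 0 :> tens U V.
Proof. by rewrite /tensv !linear0 mul0mx. Qed.

Lemma tens_span U V (t : tens U V) :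
  t = \sum_i \sum_j t i j *: tensv (vbasis {:U})`_i (vbasis {:V})`_j.
Proof.
rewrite [LHS]matrix_sum_delta; apply: eq_bigr => i _; apply: eq_bigr => j _.
congr (_ *: _); rewrite /tensv.
by rewrite !rVofE ?vbasisP // trmx_delta mul_delta_mx.
Qed.

Lemma tens_ext U V W (f g : 'Hom(tens U V, W)) :
  (forall u v, f (tensv u v) = g (tensv u v)) -> f = g.
Proof.
move=> fg; apply/lfunP => t; rewrite (tens_span t) !linear_sum.
apply: eq_bigr => i _; rewrite !linear_sum; apply: eq_bigr => j _.
by rewrite !linearZ /= fg.
Qed.

Lemma tens_ext_lin U V W (f g : tens U V -> W) : linear f -> linear g ->
  (forall u v, f (tensv u v) = g (tensv u v)) -> f =1 g.
Proof.
move=> lf lg fg t; rewrite -(linfunE lf) -(linfunE lg); congr (_ t).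
by apply: f_equal; apply: tens_ext => u v; rewrite !linfunE.
Qed.

Lemma tens_lift_param U V W Z (b : Z -> U -> V -> W) (t : tens U V) :
  (forall u v, linear (fun z : Z => b z u v)) ->
  linear (fun z : Z => tens_lift (b z) t).
Proof.
move=> lb a x y; rewrite !tens_lift_unfold scaler_sumr -big_split.
apply: eq_bigr => i _; rewrite scaler_sumr -big_split; apply: eq_bigr => j _ /=.
by rewrite lb scalerDr !scalerA mulrC.
Qed.

Definition tens_map U U' V V' (f : 'Hom(U, U')) (g : 'Hom(V, V')) :
    'Hom(tens U V, tens U' V') :=
  tens_lift (fun u v => tensv (f u) (g v)).

Lemma tens_mapE U U' V V' (f : 'Hom(U, U')) (g : 'Hom(V, V')) u v :
  tens_map f g (tensv u v) = tensv (f u) (g v).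
Proof.
apply: (@tens_liftE _ _ _ (fun u v => tensv (f u) (g v))).
have [t1 t2] := tensv_bilin U' V'.
by split=> [{}v|{}u] a x y; rewrite linearP ?t1 ?t2.
Qed.

Lemma tens_map_comp U U' U'' V V' V''
    (f' : 'Hom(U', U'')) (g' : 'Hom(V', V'')) (f : 'Hom(U, U')) (g : 'Hom(V, V')) :
  tens_map (f' \o f)%VF (g' \o g)%VF = (tens_map f' g' \o tens_map f g)%VF.
Proof. by apply: tens_ext => u v; rewrite comp_lfunE !tens_mapE !comp_lfunE. Qed.

Lemma tens_map1 U V : tens_map \1 \1 = \1%VF :> 'End(tens U V).
Proof. by apply: tens_ext => u v; rewrite tens_mapE !id_lfunE. Qed.

Definition pair_map U U' V V' (f : 'Hom(U, U')) (g : 'Hom(V, V')) :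
    'Hom((U * V)%type, (U' * V')%type) :=
  linfun (fun x : U * V => (f x.1, g x.2)).

Lemma pair_mapE U U' V V' (f : 'Hom(U, U')) (g : 'Hom(V, V')) x :
  pair_map f g x = (f x.1, g x.2).
Proof.
by apply: (linfunE (f := fun x : U * V => (f x.1, g x.2))) => a y z /=; rewrite !linearP.
Qed.

Lemma lftr_comp U V (f : 'Hom(U, V)) (g : 'Hom(V, U)) :
  lftr (f \o g)%VF = lftr (g \o f)%VF.
Proof.
rewrite /lftr (mxof_comp _ _ (vbasisP {:U})) (mxof_comp _ _ (vbasisP {:V})).
exact: mxtrace_mulC.
Qed.

Lemma lftr_linear V : scalar (@lftr V).
Proof. by move=> a f g; rewrite /lftr linearP /= mxtraceD mxtraceZ. Qed.

HB.instance Definition _ V := GRing.isLinear.Build F 'End(V) F *%R (@lftr V)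
  (@lftr_linear V).

Lemma lftr_nondeg U V (p : 'Hom(V, U)) :
  (forall u : 'Hom(U, V), lftr (u \o p)%VF = 0) -> p = 0.
Proof.
move=> up0; apply/eqP.
rewrite -(mxof_eq0 (vbasisP {:V}) (vbasisP {:U})); apply/eqP/matrixP => i j.
have := up0 (hommx (vbasis {:U}) (vbasis {:V}) (delta_mx j i)).
rewrite /lftr (mxof_comp _ _ (vbasisP {:U})) hommxK ?vbasisP // => tr0.
move: tr0; move: (mxof _ _ p) => A /= tr0; rewrite [RHS]mxE -[RHS]tr0 /mxtrace (bigD1 i) //= big1 ?addr0 => [|k /negPf ki].
  rewrite mxE (bigD1 j) //= [delta_mx _ _ _ _]mxE !eqxx mulr1 big1 ?addr0 //.
  by move=> l /negPf lj; rewrite [delta_mx _ _ _ _]mxE lj mulr0.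
by rewrite mxE big1 // => l _; rewrite [delta_mx _ _ _ _]mxE ki andbF mulr0.
Qed.

Lemma lftr_repr U V (L : 'Hom(U, V) -> F) : scalar L ->
  exists p : 'Hom(V, U), forall u, L u = lftr (u \o p)%VF.
Proof.
move=> lL; pose eU := vbasis {:U}; pose eV := vbasis {:V}.
pose D j i := hommx eU eV (delta_mx j i).
exists (hommx eV eU (\matrix_(i, j) L (D j i))) => u.
rewrite /lftr (mxof_comp _ _ (vbasisP {:U})) hommxK ?vbasisP //.
have L0 : L 0 = 0 by have := lL (-1) 0 0; rewrite scaler0 addr0 mulN1r addNr.
have LD x y : L (x + y) = L x + L y.
  by rewrite -[x]scale1r lL mul1r scale1r.
have LZ a x : L (a *: x) = a * L x by rewrite -[_ *: x]addr0 lL L0 addr0.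
rewrite -[u in LHS](mxofK (vbasisP {:U}) (vbasisP {:V})).
rewrite [mxof _ _ u in LHS]matrix_sum_delta linear_sum (big_morph L LD L0).
under eq_bigr do rewrite linear_sum (big_morph L LD L0).
rewrite /mxtrace exchange_big; apply: eq_bigr => i _; rewrite mxE.
by apply: eq_bigr => j _; rewrite linearZ LZ !mxE mulrC.
Qed.

End Linear.

Section RepC3.
Variable F : fieldType.

(* A representation of the cyclic group of order 3 is given by the action of  *)
(* the fixed generator.                                                       *)
Record rep := Rep {
  rep_space :> vectType F;
  act : 'End(rep_space);
  act_cube : (act \o act \o act = \1)%VF
}.

Implicit Types X Y Z : rep.

Definition equivar X Y : {pred 'Hom(X, Y)} :=
  [pred f : 'Hom(X, Y) | (f \o act X == act Y \o f)%VF].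

Arguments equivar : clear implicits.

Record rep_hom X Y := RepHom {
  rep_map :> 'Hom(X, Y);
  rep_mapP : rep_map \in equivar X Y
}.

HB.instance Definition _ X Y := [isSub for @rep_map X Y].
HB.instance Definition _ X Y := [Choice of rep_hom X Y by <:].

Lemma equivar_zmod_closed X Y : zmod_closed (equivar X Y).
Proof.
split=> [|f g]; rewrite !inE ?comp_lfun0l ?comp_lfun0r //.
by move=> /eqP cf /eqP cg; rewrite !(comp_lfunDl, comp_lfunDr, comp_lfunNl, comp_lfunNr) cf cg.
Qed.
HB.instance Definition _ X Y :=
  GRing.isZmodClosed.Build 'Hom(X, Y) (equivar X Y) (equivar_zmod_closed X Y).
HB.instance Definition _ X Y := [SubChoice_isSubZmodule of rep_hom X Y by <:].

Lemma rep_homE X Y (f : rep_hom X Y) x : f (act X x) = act Y (f x).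
Proof. by have /eqP/lfunP/(_ x) := rep_mapP f; rewrite !comp_lfunE. Qed.

Lemma equivarP X Y (f : 'Hom(X, Y)) :
  (forall x, f (act X x) = act Y (f x)) -> f \in equivar X Y.
Proof. by move=> fE; apply/eqP/lfunP => x; rewrite !comp_lfunE. Qed.

Lemma rep_id_subproof X : \1%VF \in equivar X X.
Proof. by apply: equivarP => x; rewrite !id_lfunE. Qed.
Definition rep_id X := RepHom (rep_id_subproof X).

Lemma rep_comp_subproof X Y Z (f : rep_hom Y Z) (g : rep_hom X Y) :
  (f \o g)%VF \in equivar X Z.
Proof. by apply: equivarP => x; rewrite !comp_lfunE !rep_homE. Qed.
Definition rep_comp X Y Z (f : rep_hom Y Z) (g : rep_hom X Y) : rep_hom X Z :=
  RepHom (rep_comp_subproof f g).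

Lemma tens_act_cube X Y (s := tens_map (act X) (act Y)) :
  (s \o s \o s = \1)%VF.
Proof. by rewrite /s -!tens_map_comp !act_cube tens_map1. Qed.
Definition rep_tens X Y : rep := Rep (@tens_act_cube X Y).

Lemma tens_hom_subproof X X' Y Y' (f : rep_hom X X') (g : rep_hom Y Y') :
  tens_map f g \in equivar (rep_tens X Y) (rep_tens X' Y').
Proof.
have /eqP cf := rep_mapP f; have /eqP cg := rep_mapP g.
by apply/eqP; rewrite /= -!tens_map_comp cf cg.
Qed.
Definition rep_tens_hom X X' Y Y' (f : rep_hom X X') (g : rep_hom Y Y') :
    rep_hom (rep_tens X Y) (rep_tens X' Y') :=
  RepHom (tens_hom_subproof f g).

Definition negligible X Y : {pred rep_hom X Y} :=
  [pred f : rep_hom X Y | `[< forall g : rep_hom Y X, lftr (f \o g)%VF = 0 >]].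

Arguments negligible : clear implicits.

Lemma negligibleP X Y (f : rep_hom X Y) :
  reflect (forall g : rep_hom Y X, lftr (f \o g)%VF = 0) (f \in negligible X Y).
Proof. exact: asboolP. Qed.

Lemma negligible_zmod_closed X Y : zmod_closed (negligible X Y).
Proof.
split=> [|f f' /negligibleP nf /negligibleP nf']; apply/negligibleP => g.
  by rewrite comp_lfun0l linear0.
by rewrite /= comp_lfunDl comp_lfunNl linearB /= nf nf' subrr.
Qed.
HB.instance Definition _ X Y :=
  GRing.isZmodClosed.Build (rep_hom X Y) (negligible X Y)
    (@negligible_zmod_closed X Y).

Lemma negligible_compl X Y Z (f : rep_hom Y Z) (g : rep_hom X Y) :
  g \in negligible X Y -> rep_comp f g \in negligible X Z.
Proof.
move=> /negligibleP ng; apply/negligibleP => h.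
by rewrite /= -comp_lfunA lftr_comp -comp_lfunA (ng (rep_comp h f)).
Qed.

Lemma negligible_compr X Y Z (f : rep_hom Y Z) (g : rep_hom X Y) :
  f \in negligible Y Z -> rep_comp f g \in negligible X Z.
Proof.
by move=> /negligibleP nf; apply/negligibleP => h; rewrite /= -comp_lfunA (nf (rep_comp g h)).
Qed.

(* Negligible morphisms form a tensor ideal: the partial trace [p] of [h] is  *)
(* equivariant.                                                               *)
Lemma negligible_tens1 X Y Z (f : rep_hom X Y) :
  f \in negligible X Y ->
  rep_tens_hom f (rep_id Z) \in negligible (rep_tens X Z) (rep_tens Y Z).
Proof.
move=> /negligibleP nf; apply/negligibleP => h.
have lin : scalar (fun u : 'Hom(X, Y) => lftr (tens_map u \1%VF \o h)%VF).
  move=> a u v; rewrite -linearP /=; congr lftr.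
  rewrite comp_lfunZl -comp_lfunDl; congr (_ \o _)%VF; apply: tens_ext => x z.
  rewrite add_lfunE scale_lfunE !tens_mapE add_lfunE scale_lfunE.
  by have [-> _] := @tensv_bilin F Y Z.
have [p pE] := lftr_repr lin.
suff pP : p \in equivar Y X by rewrite /= pE; exact: (nf (RepHom pP)).
have tid (T : rep) : (act T \o (act T \o act T) = \1)%VF.
  by rewrite comp_lfunA act_cube.
pose sg := (act Z \o act Z)%VF; pose t0 := tens_map \1%VF sg : 'End(tens X Z).
pose t1 := tens_map \1%VF sg : 'End(tens Y Z).
have hs : (h \o tens_map (act Y) (act Z) = tens_map (act X) (act Z) \o h)%VF.
  exact: (eqP (rep_mapP h)).
have s0 : tens_map (act X) \1%VF = (tens_map (act X) (act Z) \o t0)%VF.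
  by rewrite -tens_map_comp comp_lfun1r tid.
have s1 : tens_map (act Y) \1%VF = (tens_map (act Y) (act Z) \o t1)%VF.
  by rewrite -tens_map_comp comp_lfun1r tid.
apply/eqP/subr0_eq/lftr_nondeg => u.
rewrite comp_lfunDr comp_lfunNr linearB /=; apply/eqP; rewrite subr_eq0; apply/eqP.
rewrite comp_lfunA lftr_comp comp_lfunA -pE [in RHS]comp_lfunA -pE.
have -> : tens_map (act Y \o u)%VF \1%VF = (tens_map (act Y) \1 \o tens_map u \1)%VF.
  by move=> T; rewrite -tens_map_comp comp_lfun1r.
have -> : tens_map (u \o act X)%VF \1%VF = (tens_map u \1 \o tens_map (act X) \1)%VF.
  by move=> T; rewrite -tens_map_comp comp_lfun1r.
have ut : (tens_map u \1 \o t0 = t1 \o tens_map u \1%VF)%VF.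
  by rewrite -!tens_map_comp !comp_lfun1l !comp_lfun1r.
have ct : (tens_map (act X) (act Z) \o t0 = t0 \o tens_map (act X) (act Z))%VF.
  by rewrite -!tens_map_comp !comp_lfun1l !comp_lfun1r /sg comp_lfunA.
rewrite s0 s1 ct; set SX := tens_map (act X) _; set SY := tens_map (act Y) _.
rewrite -/SX -/SY in hs *; set u1 := tens_map u _.
have -> : (u1 \o (t0 \o SX) \o h = t1 \o u1 \o h \o SY)%VF.
  by rewrite !comp_lfunA ut -!comp_lfunA hs.
by rewrite [RHS]lftr_comp !comp_lfunA.
Qed.

Lemma rep_swap_subproof X Y :
  tens_lift (fun (x : X) (y : Y) => tensv y x)
    \in equivar (rep_tens X Y) (rep_tens Y X).
Proof.
have sb : bilin (fun (x : X) (y : Y) => tensv y x).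
  by have [h1 h2] := @tensv_bilin F Y X; split.
apply/eqP/tens_ext => x y.
by rewrite /= !comp_lfunE /= tens_mapE !(tens_liftE sb) tens_mapE.
Qed.
Definition rep_swap X Y : rep_hom (rep_tens X Y) (rep_tens Y X) :=
  RepHom (rep_swap_subproof X Y).

Lemma rep_swapE X Y (x : X) (y : Y) : rep_swap X Y (tensv x y) = tensv y x.
Proof.
apply: (@tens_liftE F X Y (tens Y X) (fun (x : X) (y : Y) => tensv y x)).
by have [h1 h2] := @tensv_bilin F Y X; split.
Qed.

Lemma negligible_tensl X X' Y Y' (f : rep_hom X X') (g : rep_hom Y Y') :
  f \in negligible X X' ->
  rep_tens_hom f g \in negligible (rep_tens X Y) (rep_tens X' Y').
Proof.
move=> nf.
have -> : rep_tens_hom f g =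
    rep_comp (rep_tens_hom (rep_id X') g) (rep_tens_hom f (rep_id Y)).
  by apply/val_inj; rewrite /= -tens_map_comp comp_lfun1l comp_lfun1r.
exact/negligible_compl/negligible_tens1.
Qed.

Lemma negligible_tensr X X' Y Y' (f : rep_hom X X') (g : rep_hom Y Y') :
  g \in negligible Y Y' ->
  rep_tens_hom f g \in negligible (rep_tens X Y) (rep_tens X' Y').
Proof.
move=> ng.
have -> : rep_tens_hom f g =
    rep_comp (rep_swap Y' X') (rep_comp (rep_tens_hom g f) (rep_swap X Y)).
  apply/val_inj/tens_ext => x y.
  have sE := rep_swapE; rewrite /= in sE.
  by rewrite /= !comp_lfunE /= sE !tens_mapE sE.
exact/negligible_compl/negligible_compr/negligible_tensl.
Qed.

Definition ver_hom X Y := Quotient.quot (negligible X Y).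

Definition ver_class X Y (f : rep_hom X Y) : ver_hom X Y := \pi_(ver_hom X Y)%qT f.

Lemma ver_classP X Y (f g : rep_hom X Y) :
  ver_class f = ver_class g <-> f - g \in negligible X Y.
Proof. by rewrite Quotient.idealrBE; split=> /eqP. Qed.

Lemma ver_repr X Y (f : ver_hom X Y) : ver_class (repr f) = f.
Proof. exact: reprK. Qed.

Definition ver_id X : ver_hom X X := ver_class (rep_id X).

(* Composition and tensor product do not depend on the representatives, by    *)
(* [ver_compE] and [ver_tensE].                                               *)
Definition ver_comp X Y Z (f : ver_hom Y Z) (g : ver_hom X Y) : ver_hom X Z :=
  ver_class (rep_comp (repr f) (repr g)).

Definition ver_tens_hom X X' Y Y' (f : ver_hom X X') (g : ver_hom Y Y') :
    ver_hom (rep_tens X Y) (rep_tens X' Y') :=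
  ver_class (rep_tens_hom (repr f) (repr g)).

Lemma ver_compE X Y Z (f : rep_hom Y Z) (g : rep_hom X Y) :
  ver_comp (ver_class f) (ver_class g) = ver_class (rep_comp f g).
Proof.
apply/ver_classP; set f' := repr _; set g' := repr _.
have nf : f' - f \in negligible Y Z by apply/ver_classP; exact: ver_repr.
have ng : g' - g \in negligible X Y by apply/ver_classP; exact: ver_repr.
have -> : rep_comp f' g' - rep_comp f g =
    rep_comp (f' - f) g' + rep_comp f (g' - g).
  apply/val_inj => /=.
  by rewrite comp_lfunDl comp_lfunDr comp_lfunNl comp_lfunNr addrA subrK.
exact: rpredD (negligible_compr g' nf) (negligible_compl f ng).
Qed.

Lemma ver_tensE X X' Y Y' (f : rep_hom X X') (g : rep_hom Y Y') :
  ver_tens_hom (ver_class f) (ver_class g) = ver_class (rep_tens_hom f g).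
Proof.
apply/ver_classP; set f' := repr _; set g' := repr _.
have nf : f' - f \in negligible X X' by apply/ver_classP; exact: ver_repr.
have ng : g' - g \in negligible Y Y' by apply/ver_classP; exact: ver_repr.
have -> : rep_tens_hom f' g' - rep_tens_hom f g =
    rep_tens_hom (f' - f) g' + rep_tens_hom f (g' - g).
  apply/val_inj/tens_ext => x y /=.
  rewrite !add_lfunE !opp_lfunE !tens_mapE !add_lfunE !opp_lfunE.
  have [h1 h2] := @tensv_bilin F X' Y'.
  have -> : f' x - f x = (-1) *: f x + f' x by rewrite scaleN1r addrC.
  have -> : g' y - g y = (-1) *: g y + g' y by rewrite scaleN1r addrC.
  by rewrite h1 h2 !scaleN1r [RHS]addrC addrA addrK [RHS]addrC.
exact: rpredD (negligible_tensl g' nf) (negligible_tensr f ng).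
Qed.

Definition ver_iso X Y (f : ver_hom X Y) : Prop :=
  exists g : ver_hom Y X, ver_comp g f = ver_id X /\ ver_comp f g = ver_id Y.

Record ver_alg := VerAlg {
  ver_alg_ob :> rep;
  ver_mul : ver_hom (rep_tens ver_alg_ob ver_alg_ob) ver_alg_ob
}.

Definition ver_alg_isomorphic (A B : ver_alg) : Prop :=
  exists f : ver_hom A B,
    ver_iso f /\
    ver_comp f (ver_mul A) = ver_comp (ver_mul B) (ver_tens_hom f f).

End RepC3.

Arguments equivar {F} X Y.
Arguments negligible {F} X Y.

Section SVec.
Variable F : fieldType.

Record svec := SVec { even_part : vectType F; odd_part : vectType F }.
Implicit Types X Y : svec.

Record svec_hom X Y := SVecHom {
  hom_even : 'Hom(even_part X, even_part Y);
  hom_odd : 'Hom(odd_part X, odd_part Y)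
}.

Definition svec_tens X Y : svec := SVec
  (tens (even_part X) (even_part Y) * tens (odd_part X) (odd_part Y))%type
  (tens (even_part X) (odd_part Y) * tens (odd_part X) (even_part Y))%type.

End SVec.

Section Char3.
Variables (F : fieldType) (char3 : 3%N \in [pchar F]).

(* [jordan n] sends the [i]-th basis row to the sum of the [i]-th and         *)
(* [i.+1]-st ones, the last one being fixed.                                  *)
Definition jordan (n : nat) : 'End('rV[F]_n.+1) :=
  linfun (mulmxr (\matrix_(i, j) ((i == j) || (i.+1 == j :> nat))%:R)).

Lemma jordanE n (i : 'I_n.+1) :
  jordan n (delta_mx 0 i) =
  delta_mx 0 i + (if (i.+1 < n.+1)%N then delta_mx 0 (inord i.+1) else 0).
Proof.
rewrite lfunE /= -rowE; apply/rowP => j; rewrite !mxE eqxx /= [j == i]eq_sym.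
case: ltnP => lin; rewrite !mxE ?eqxx /=.
  have -> : (j == inord i.+1) = (i.+1 == j :> nat).
    by rewrite -val_eqE /= inordK // eq_sym.
  case: eqP => [->|_] /=; last by rewrite add0r.
  by rewrite (gtn_eqF (ltnSn _)) addr0.
rewrite addr0; congr (_%:R); rewrite [i.+1 == _]gtn_eqF ?orbF //.
exact: leq_trans (ltn_ord j) lin.
Qed.

Lemma jordan_cube n : (n < 3)%N ->
  (jordan n \o jordan n \o jordan n = \1)%VF.
Proof.
move=> n3; apply/lfunP => u; rewrite !comp_lfunE !lfunE /=.
have e3 : 1 + 1 + 1 = 0 :> F by rewrite -(pcharf0 char3) !mulrSr add0r.
apply/rowP; case: n n3 u => [|[|[|//]]] _ u [[|[|[|//]]] lj] //.
all: rewrite !(mxE, big_ord_recl, big_ord0) /=.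
- by rewrite (_ : Ordinal lj = ord0); [ring | exact: val_inj].
- by rewrite (_ : Ordinal lj = ord0); [ring | exact: val_inj].
- rewrite (_ : Ordinal lj = lift ord0 ord0); last exact: val_inj.
  transitivity (u 0 (lift ord0 ord0) + (1 + 1 + 1) * u 0 ord0); first by ring.
  by rewrite e3 mul0r addr0.
- by rewrite (_ : Ordinal lj = ord0); [ring | exact: val_inj].
- rewrite (_ : Ordinal lj = lift ord0 ord0); last exact: val_inj.
  transitivity (u 0 (lift ord0 ord0) + (1 + 1 + 1) * u 0 ord0); first by ring.
  by rewrite e3 mul0r addr0.
- rewrite (_ : Ordinal lj = lift ord0 (lift ord0 ord0)); last exact: val_inj.
  transitivity (u 0 (lift ord0 (lift ord0 ord0)) +
    (1 + 1 + 1) * (u 0 ord0 + u 0 (lift ord0 ord0))); first by ring.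
  by rewrite e3 mul0r addr0.
Qed.

Definition indec (n : nat) (n_lt3 : (n < 3)%N) : rep F :=
  @Rep F 'rV[F]_n.+1 (jordan n) (jordan_cube n_lt3).

Definition V0 := @indec 0 isT.
Definition V1 := @indec 1 isT.
Definition V2 := @indec 2 isT.

Definition v0 : V1 := delta_mx 0 0.
Definition v1 : V1 := delta_mx 0 1.

Definition lambda (u v : V1) : F :=
  (u : 'rV[F]_2) 0 0 * (v : 'rV[F]_2) 0 1 - (u : 'rV[F]_2) 0 1 * (v : 'rV[F]_2) 0 0.

Lemma lambdaE : [/\ lambda v0 v1 = 1, lambda v1 v0 = -1, lambda v0 v0 = 0
  & lambda v1 v1 = 0].
Proof. by split; rewrite /lambda !mxE /= ?mulr0 ?mul0r ?mulr1 ?subr0 ?sub0r. Qed.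

Lemma F_act_cube (X : svec F)
    (s := pair_map \1 (tens_map \1 (act V1))
       : 'End((even_part X * tens (odd_part X) V1)%type)) :
  (s \o s \o s = \1)%VF.
Proof.
apply/lfunP => -[x y]; rewrite /s !comp_lfunE !pair_mapE /= !id_lfunE.
congr pair; rewrite -[RHS]id_lfunE -(tens_map1 _ V1) -(act_cube V1).
by rewrite -!comp_lfunE -!tens_map_comp !comp_lfun1l.
Qed.

Definition F_ob (X : svec F) : rep F :=
  @Rep F (even_part X * tens (odd_part X) V1)%type _ (@F_act_cube X).

Lemma F_hom_subproof (X Y : svec F) (f : svec_hom X Y) :
  pair_map (hom_even f) (tens_map (hom_odd f) (\1 : 'End(V1))%VF)
    \in equivar (F_ob X) (F_ob Y).
Proof.
apply: equivarP => -[x y]; rewrite /= !pair_mapE /= !id_lfunE.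
by rewrite -!comp_lfunE -!tens_map_comp !comp_lfun1l !comp_lfun1r.
Qed.

Definition F_hom (X Y : svec F) (f : svec_hom X Y) : ver_hom (F_ob X) (F_ob Y) :=
  ver_class (RepHom (F_hom_subproof f)).

Section MonoidalStructure.
Variables X Y : svec F.
Local Notation X0 := (even_part X).
Local Notation X1 := (odd_part X).
Local Notation Y0 := (even_part Y).
Local Notation Y1 := (odd_part Y).
Local Notation XY0 := (tens X0 Y0 * tens X1 Y1)%type.
Local Notation XY1 := (tens X0 Y1 * tens X1 Y0)%type.

Definition J01 (x0 : X0) : 'Hom(tens Y1 V1, tens XY1 V1) :=
  tens_lift (fun (y1 : Y1) (v : V1) => tensv ((tensv x0 y1, 0) : XY1) v).

Definition J10 (y0 : Y0) : 'Hom(tens X1 V1, tens XY1 V1) :=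
  tens_lift (fun (x1 : X1) (v : V1) => tensv ((0, tensv x1 y0) : XY1) v).

Definition J11 (s : tens X1 V1) (t : tens Y1 V1) : tens X1 Y1 :=
  tens_lift (fun (x1 : X1) (u : V1) =>
    tens_lift (fun (y1 : Y1) (v : V1) => lambda u v *: tensv x1 y1) t) s.

Lemma lambda_linl v a u u' : lambda (a *: u + u') v = a * lambda u v + lambda u' v.
Proof. by rewrite /lambda !mxE; ring. Qed.

Lemma lambda_linr v a u u' : lambda v (a *: u + u') = a * lambda v u + lambda v u'.
Proof. by rewrite /lambda !mxE; ring. Qed.

Lemma J01_bilin (x0 : X0) :
  bilin (fun (y1 : Y1) (v : V1) => tensv ((tensv x0 y1, 0) : XY1) v).
Proof.
have [h1 h2] := @tensv_bilin F XY1 V1; have [h3 h4] := @tensv_bilin F X0 Y1.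
split=> [v|y1] a b c; last exact: h2.
rewrite -h1; congr (tensv _ _); apply/pair_equal_spec; split=> /=.
  exact: h4.
by rewrite scaler0 addr0.
Qed.

Lemma J01E x0 y1 v : J01 x0 (tensv y1 v) = tensv ((tensv x0 y1, 0) : XY1) v.
Proof. exact: (tens_liftE (J01_bilin x0)). Qed.

Lemma J10_bilin (y0 : Y0) :
  bilin (fun (x1 : X1) (v : V1) => tensv ((0, tensv x1 y0) : XY1) v).
Proof.
have [h1 h2] := @tensv_bilin F XY1 V1; have [h3 h4] := @tensv_bilin F X1 Y0.
split=> [v|y1] a b c; last exact: h2.
rewrite -h1; congr (tensv _ _); apply/pair_equal_spec; split=> /=.
  by rewrite scaler0 addr0.
exact: h3.
Qed.

Lemma J10E y0 x1 v : J10 y0 (tensv x1 v) = tensv ((0, tensv x1 y0) : XY1) v.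
Proof. exact: (tens_liftE (J10_bilin y0)). Qed.

Lemma J11_inner_bilin (x1 : X1) (u : V1) :
  bilin (fun (y1 : Y1) (v : V1) => lambda u v *: tensv x1 y1).
Proof.
have [h1 h2] := @tensv_bilin F X1 Y1.
split=> [v|y1] a b c; first by rewrite h2 scalerDr !scalerA mulrC.
by rewrite lambda_linr scalerDl scalerA.
Qed.

Lemma J11_outer_bilin (t : tens Y1 V1) :
  bilin (fun (x1 : X1) (u : V1) =>
    tens_lift (fun (y1 : Y1) (v : V1) => lambda u v *: tensv x1 y1) t).
Proof.
have [h1 h2] := @tensv_bilin F X1 Y1.
split=> [u|x1].
  apply: (@tens_lift_param F Y1 V1 _ X1
    (fun x1 y1 v => lambda u v *: tensv x1 y1)) => y1 v a b c.
  by rewrite h1 scalerDr !scalerA mulrC.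
apply: (@tens_lift_param F Y1 V1 _ V1
  (fun u y1 v => lambda u v *: tensv x1 y1)) => y1 v a b c.
by rewrite lambda_linl scalerDl scalerA.
Qed.

Lemma J11_bilin : bilin J11.
Proof.
split=> [t a b c|s a b c]; first by rewrite /J11 linearP.
apply: (@tens_lift_param F X1 V1 _ (tens Y1 V1) (fun t x1 u =>
    tens_lift (fun (y1 : Y1) (v : V1) => lambda u v *: tensv x1 y1) t)).
by move=> u v a' b' c'; rewrite linearP.
Qed.

Lemma J11E x1 u y1 v :
  J11 (tensv x1 u) (tensv y1 v) = lambda u v *: tensv x1 y1.
Proof.
by rewrite /J11 (tens_liftE (J11_outer_bilin _)) (tens_liftE (J11_inner_bilin _ _)).
Qed.

Definition J_fun (x : F_ob X) (y : F_ob Y) : F_ob (svec_tens X Y) :=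
  ((tensv x.1 y.1, J11 x.2 y.2), J01 x.1 y.2 + J10 y.1 x.2).

Lemma J01_lin y : linear (J01^~ y).
Proof.
apply: (@tens_lift_param F Y1 V1 _ X0
  (fun x0 (y1 : Y1) (v : V1) => tensv ((tensv x0 y1, 0) : XY1) v)).
move=> y1 v a b c; have [h1 _] := @tensv_bilin F XY1 V1.
rewrite -h1; congr (tensv _ _); apply/pair_equal_spec; split=> /=.
  by have [h _] := @tensv_bilin F X0 Y1; exact: h.
by rewrite scaler0 addr0.
Qed.

Lemma J10_lin x : linear (J10^~ x).
Proof.
apply: (@tens_lift_param F X1 V1 _ Y0
  (fun y0 (x1 : X1) (v : V1) => tensv ((0, tensv x1 y0) : XY1) v)).
move=> y1 v a b c; have [h1 _] := @tensv_bilin F XY1 V1.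
rewrite -h1; congr (tensv _ _); apply/pair_equal_spec; split=> /=.
  by rewrite scaler0 addr0.
by have [_ h] := @tensv_bilin F X1 Y0; exact: h.
Qed.

Lemma J_bilin : bilin J_fun.
Proof.
have [h1 h2] := @tensv_bilin F X0 Y0; have [k1 k2] := J11_bilin.
split=> [y a b c|x a b c]; rewrite /J_fun /=.
  rewrite h1 k1 J01_lin linearP; apply/pair_equal_spec; split=> //=.
  by rewrite scalerDr addrACA.
rewrite h2 k2 J10_lin linearP; apply/pair_equal_spec; split=> //=.
by rewrite scalerDr addrACA.
Qed.

Lemma J_subproof : tens_lift J_fun
  \in equivar (rep_tens (F_ob X) (F_ob Y)) (F_ob (svec_tens X Y)).
Proof.
apply/eqP/tens_ext => -[x0 x] [y0 y]; rewrite /= !comp_lfunE /=.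
rewrite tens_mapE !(tens_liftE J_bilin) !pair_mapE /J_fun /= !id_lfunE.
apply/pair_equal_spec; split.
  apply/pair_equal_spec; split=> //.
  have [k1 k2] := J11_bilin.
  move: x; apply: tens_ext_lin; rewrite ?k1 //.
    by move=> a b c; rewrite linearP k1.
  move=> x1 u; rewrite tens_mapE id_lfunE.
  move: y; apply: tens_ext_lin.
  - by move=> a b c; rewrite linearP k2.
  - by move=> a b c; rewrite k2.
  move=> y1 v; rewrite tens_mapE id_lfunE !J11E; congr (_ *: _).
  rewrite /lambda !lfunE /= !(mxE, big_ord_recl, big_ord0) /=.
  have -> : (1 : 'I_2) = lift ord0 ord0 by exact: val_inj.
  have -> : (0 : 'I_2) = ord0 by exact: val_inj.
  by ring.
rewrite linearD; congr (_ + _).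
  move: y; apply: tens_ext_lin => [a b c|a b c|y1 v]; rewrite ?linearP //.
  by rewrite /= tens_mapE !J01E tens_mapE !id_lfunE.
move: x; apply: tens_ext_lin => [a b c|a b c|x1 v]; rewrite ?linearP //.
by rewrite /= tens_mapE !J10E tens_mapE !id_lfunE.
Qed.

Definition J_hom : rep_hom (rep_tens (F_ob X) (F_ob Y)) (F_ob (svec_tens X Y)) :=
  RepHom J_subproof.

Lemma J_homE x y : J_hom (tensv x y) = J_fun x y.
Proof. exact: (tens_liftE J_bilin). Qed.

Lemma J_hom00 (x0 : X0) (y0 : Y0) :
  J_hom (tensv ((x0, 0) : F_ob X) ((y0, 0) : F_ob Y)) = ((tensv x0 y0, 0), 0).
Proof.
by rewrite J_homE /J_fun /= /J11 !linear0 addr0.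
Qed.

Lemma J_hom01 (x0 : X0) (y1 : Y1) (v : V1) :
  J_hom (tensv ((x0, 0) : F_ob X) ((0, tensv y1 v) : F_ob Y)) =
  ((0, 0), tensv ((tensv x0 y1, 0) : XY1) v).
Proof. by rewrite J_homE /J_fun /= tensv0 J01E /J11 !linear0 addr0. Qed.

Lemma J_hom10 (x1 : X1) (v : V1) (y0 : Y0) :
  J_hom (tensv ((0, tensv x1 v) : F_ob X) ((y0, 0) : F_ob Y)) =
  ((0, 0), tensv ((0, tensv x1 y0) : XY1) v).
Proof.
rewrite J_homE /J_fun /= tens0v J10E linear0 add0r.
have [_ k2] := J11_bilin.
suff -> : J11 (tensv x1 v) 0 = 0 by [].
by have := k2 (tensv x1 v) (-1) 0 0; rewrite scaler0 addr0 scaleN1r addNr.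
Qed.

Lemma J_hom11 (x1 : X1) (u : V1) (y1 : Y1) (v : V1) :
  J_hom (tensv ((0, tensv x1 u) : F_ob X) ((0, tensv y1 v) : F_ob Y)) =
  ((0, lambda u v *: tensv x1 y1), 0).
Proof.
rewrite J_homE /J_fun /= tens0v J11E.
have -> : J01 0 (tensv y1 v) = 0 by rewrite J01E tens0v tens0v.
by have -> : J10 0 (tensv x1 u) = 0; rewrite ?addr0 ?J10E ?tensv0 ?tens0v.
Qed.

Definition J : ver_hom (rep_tens (F_ob X) (F_ob Y)) (F_ob (svec_tens X Y)) :=
  ver_class J_hom.
End MonoidalStructure.

(* [U] is an internal direct sum of subrepresentations isomorphic to [V].     *)
Definition sum_of_copies (A V : rep F) (U : {vspace A}) : Prop :=
  exists n (i : 'I_n -> rep_hom V A),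
    [/\ forall k, lker (i k) = 0%VS,
        directv (\sum_k limg (i k)) & (U = \sum_k limg (i k))%VS].

Definition delta (A : rep F) : 'End(A) := (act A - \1)%VF.

(* [B1] is the complement of its image under [delta] in [A1]; [A0] and [B1]    *)
(* become the even and odd parts of the superspace.                           *)
Section Splitting.
Variables (A : rep F) (A0 A1 A2 B1 : {vspace A}).
Local Notation dB1 := (delta A @: B1)%VS.

Definition is_splitting : Prop :=
  [/\ directv (A0 + A1 + A2), (A0 + A1 + A2 = fullv)%VS,
      sum_of_copies V0 A0, sum_of_copies V1 A1 & sum_of_copies V2 A2].

Definition is_refinement : Prop := directv (B1 + dB1) /\ (B1 + dB1 = A1)%VS.

Variable mu : rep_hom (rep_tens A A) A.
Local Notation "x ** y" := (mu (tensv x y)) (at level 40).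

Definition ss_proj0 (z : A) : subvs_of A0 :=
  vsproj A0 (daddv_pi A0 (B1 + dB1 + A2) z).
Definition ss_proj1 (z : A) : subvs_of B1 :=
  vsproj B1 (daddv_pi B1 (A0 + dB1 + A2) z).

Definition ss_space : svec F := SVec (subvs_of A0) (subvs_of B1).
Local Notation S := ss_space.

Definition ss_even_fun (t : even_part (svec_tens S S)) : even_part S :=
  tens_lift (fun x0 y0 : subvs_of A0 => ss_proj0 (vsval x0 ** vsval y0)) t.1 +
  tens_lift (fun x1 y1 : subvs_of B1 => ss_proj0 (vsval x1 ** delta A (vsval y1))) t.2.

Definition ss_odd_fun (t : odd_part (svec_tens S S)) : odd_part S :=
  tens_lift (fun (x0 : subvs_of A0) (y1 : subvs_of B1) =>
    ss_proj1 (vsval x0 ** vsval y1)) t.1 +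
  tens_lift (fun (x1 : subvs_of B1) (y0 : subvs_of A0) =>
    ss_proj1 (vsval x1 ** vsval y0)) t.2.

Definition ss_mul : svec_hom (svec_tens S S) S :=
  SVecHom (linfun ss_even_fun) (linfun ss_odd_fun).


Lemma ss_proj0_linear : linear ss_proj0.
Proof. by move=> a x y; rewrite /ss_proj0 !linearP. Qed.

Lemma ss_proj1_linear : linear ss_proj1.
Proof. by move=> a x y; rewrite /ss_proj1 !linearP. Qed.

Lemma ss_mul_bilin (U V W : vectType F) (p : A -> W) (f : U -> A) (g : V -> A) :
  linear p -> linear f -> linear g -> @bilin F U V W (fun u v => p (f u ** g v)).
Proof.
move=> lp lf lg; have [h1 h2] := @tensv_bilin F A A.
by split=> [v|u] a b c; rewrite (lf, lg) (h1, h2) linearP lp.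
Qed.

Lemma ss_even_linear : linear ss_even_fun.
Proof.
by move=> a s t; rewrite /ss_even_fun !linearP scalerDr addrACA.
Qed.

Lemma ss_odd_linear : linear ss_odd_fun.
Proof.
by move=> a s t; rewrite /ss_odd_fun !linearP scalerDr addrACA.
Qed.

Lemma ss_mul00 (x0 y0 : subvs_of A0) :
  hom_even ss_mul (tensv x0 y0, 0) = ss_proj0 (vsval x0 ** vsval y0).
Proof.
rewrite /= (linfunE ss_even_linear) /ss_even_fun /= linear0 addr0 tens_liftE //.
by apply: ss_mul_bilin => [|a b c|a b c]; rewrite ?linearP //; apply: ss_proj0_linear.
Qed.

Lemma ss_mul11 (x1 y1 : subvs_of B1) :
  hom_even ss_mul (0, tensv x1 y1) = ss_proj0 (vsval x1 ** delta A (vsval y1)).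
Proof.
rewrite /= (linfunE ss_even_linear) /ss_even_fun /= linear0 add0r.
rewrite (@tens_liftE _ _ _ _ (fun x1 y1 => ss_proj0 (vsval x1 ** delta A (vsval y1)))) //.
apply: (@ss_mul_bilin _ _ _ ss_proj0 _ (fun y1 => delta A (vsval y1))) => [|a b c|a b c].
- exact: ss_proj0_linear.
- by rewrite linearP.
- by rewrite !linearP.
Qed.

Lemma ss_mul01 (x0 : subvs_of A0) (y1 : subvs_of B1) :
  hom_odd ss_mul (tensv x0 y1, 0) = ss_proj1 (vsval x0 ** vsval y1).
Proof.
rewrite /= (linfunE ss_odd_linear) /ss_odd_fun /= linear0 addr0 tens_liftE //.
by apply: ss_mul_bilin => [|a b c|a b c]; rewrite ?linearP //; apply: ss_proj1_linear.
Qed.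

Lemma ss_mul10 (x1 : subvs_of B1) (y0 : subvs_of A0) :
  hom_odd ss_mul (0, tensv x1 y0) = ss_proj1 (vsval x1 ** vsval y0).
Proof.
rewrite /= (linfunE ss_odd_linear) /ss_odd_fun /= linear0 add0r tens_liftE //.
by apply: ss_mul_bilin => [|a b c|a b c]; rewrite ?linearP //; apply: ss_proj1_linear.
Qed.

End Splitting.
End Char3.

(* Main.v *)
Require Import Defs.
From HB Require Import structures.
From mathcomp Require Import all_boot all_order all_algebra.
From mathcomp Require Import boolp ring.

Set Implicit Arguments.
Unset Strict Implicit.
Unset Printing Implicit Defensive.

Import GRing.Theory.
Local Open Scope ring_scope.

(* Let i : F(A) -> A send a + x (x) v0 + y (x) v1 to a + x + delta y, and let *)
(* p be its left inverse vanishing on A2. A map of the form                   *)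
(* T sigma - sigma T is orthogonal to all equivariant maps under the trace    *)
(* pairing, so it is negligible as soon as it is equivariant. The identity of *)
(* V2 is of this form, hence so is 1 - i p, and [p] is invertible with        *)
(* inverse [i]. The difference p mu (i (x) i) - F(m) J is of this form too,   *)
(* so [p] is multiplicative.                                                  *)

(** Everything rests on [commutator_negligible], which reduces negligibility to the cyclicity of the
    trace. By [V2_commutator] it annihilates the summand [A2], so in Ver_3 the object [A] becomes
    F(S), S being the superspace with parts [A0] and [B1] ([split_incl_proj_negligible]). Comparing
    products is then a computation with elements a + x + delta y, where a is even and x, y are odd.
    On products, [delta] is a twisted derivation ([delta_mul]), and the projections onto [A0] and
    [B1] vanish on its image. Hence delta can be moved across a product at the cost of a sign under
    the even projection ([ss_proj0_skew]), which matches the antisymmetry of lambda, while the odd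
    projection kills products with a factor delta y ([ss_proj1_mul_delta], where 2 is inverted).
    What survives beyond the product of S is a few terms in a and x, without y. Since x is the
    delta-coordinate of delta u, these terms factor through delta (even part) and delta^2 (odd
    part), and [F_ob_negligible] turns such a factorisation into a commutator. *)

Section Negligible.
Variable F : fieldType.
Implicit Types X Y : rep F.

(** For equivariant g, tr(T sigma g) = tr(T g sigma) = tr(sigma T g); [T] itself need not be
    equivariant. *)
Lemma commutator_negligible X Y (f : rep_hom X Y) (T : 'Hom(X, Y)) :
  (forall x, f x = T (act X x) - act Y (T x)) -> f \in negligible X Y.
Proof.
move=> fT; apply/negligibleP => g.
have -> : (f \o g = (T \o act X \o g) - (act Y \o T \o g))%VF.
  by apply/lfunP => y; rewrite add_lfunE opp_lfunE !comp_lfunE fT.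
have /eqP gE := rep_mapP g.
by rewrite linearB /= -comp_lfunA -gE comp_lfunA lftr_comp comp_lfunA subrr.
Qed.

Lemma deltaE X (x : X) : delta X x = act X x - x.
Proof. by rewrite add_lfunE opp_lfunE id_lfunE. Qed.

Lemma actE X (x : X) : act X x = x + delta X x.
Proof. by rewrite deltaE addrC subrK. Qed.

Lemma rep_hom_delta X Y (f : rep_hom X Y) x : f (delta X x) = delta Y (f x).
Proof. by rewrite !deltaE linearB /= rep_homE. Qed.

Section Copies.
Variables (A V : rep F) (U : {vspace A}).
Hypothesis copies : sum_of_copies V U.

Lemma copies_ind (P : A -> Prop) :
  P 0 -> (forall x y, P x -> P y -> P (x + y)) ->
  (forall (i : rep_hom V A) y, P (i y)) -> forall x, x \in U -> P x.
Proof.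
move=> P0 PD Pi x; have [n [i [_ _ ->]]] := copies.
case/memv_sumP=> xs xsP ->; apply: big_ind => // k _.
by have /memv_imgP[y _ ->] := xsP k isT; apply: Pi.
Qed.

(** Packs the copies into one injective map from a power of [V] onto [U], so that operators on [V]
    can be applied copy by copy. *)
Lemma copies_inj_sum : exists n (s : 'Hom({ffun 'I_n -> V}, A)) (i : 'I_n -> rep_hom V A),
  [/\ lker s == 0%VS, forall y, s y = \sum_k i k (y k) &
      forall x, x \in U <-> exists y, x = s y].
Proof.
have [n [i [inj dir UE]]] := copies; exists n.
have lin : linear (fun y : {ffun 'I_n -> V} => \sum_k i k (y k)).
  move=> a y z; rewrite scaler_sumr -big_split; apply: eq_bigr => k _ /=.
  by rewrite !ffunE linearP.
exists (linfun (fun y : {ffun 'I_n -> V} => \sum_k i k (y k))), i; split=> [|y|x].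
- rewrite -subv0; apply/subvP => y; rewrite memv_ker (linfunE lin) memv0 => /eqP y0.
  apply/eqP/ffunP => k; rewrite ffunE; apply/eqP; rewrite -memv0 -(inj k) memv_ker.
  apply/eqP; move/directv_sum_independent: dir => /(_ (fun k => i k (y k))); apply=> // j _.
  exact: memv_img (memvf _).
- by rewrite (linfunE lin).
- rewrite UE; split=> [/memv_sumP[xs xsP ->]|[y ->]].
    exists [ffun k => (i k)^-1%VF (xs k)]; rewrite (linfunE lin).
    by apply: eq_bigr => k _; rewrite ffunE limg_lfunVK ?xsP.
  by rewrite (linfunE lin); apply: memv_sumr => k _; apply: memv_img (memvf _).
Qed.

Lemma copies_act x : x \in U -> act A x \in U.
Proof.
have [n [s [i [_ sE UE]]]] := copies_inj_sum; case/UE=> y ->; apply/UE.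
exists [ffun k => act V (y k)]; rewrite !sE linear_sum; apply: eq_bigr => k _.
by rewrite ffunE rep_homE.
Qed.

Lemma copies_delta_ker : (forall y, delta V y = 0 -> exists z, y = delta V z) ->
  forall x, x \in U -> delta A x = 0 -> exists2 z, z \in U & x = delta A z.
Proof.
move=> exV; have [n [s [i [/lker0P inj sE UE]]]] := copies_inj_sum => x /UE[y ->] y0.
have dE (z : {ffun 'I_n -> V}) : delta A (s z) = s [ffun k => delta V (z k)].
  rewrite !sE linear_sum; apply: eq_bigr => k _.
  by rewrite ffunE rep_hom_delta.
have {}y0 k : delta V (y k) = 0.
  by move: y0; rewrite dE -(linear0 s) => /inj/ffunP/(_ k); rewrite !ffunE.
have [z zE] := choice (fun k => exV _ (y0 k)).
exists (s (finfun z)); first by apply/UE; exists (finfun z).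
by rewrite dE; congr (s _); apply/ffunP => k; rewrite !ffunE zE.
Qed.

(** Apply [T] in every copy. The operator is transported to all of [A] by [s^-1], a left inverse of
    the injective [s]; only its values on [U] matter. *)
Lemma copies_commutator (T : 'End(V)) :
  (forall y, y = T (act V y) - act V (T y)) ->
  exists S : 'End(A), forall x, x \in U -> x = S (act A x) - act A (S x).
Proof.
move=> TE; have [n [s [i [inj sE UE]]]] := copies_inj_sum.
pose m (R : 'End(V)) (y : {ffun 'I_n -> V}) := [ffun k => R (y k)] : {ffun 'I_n -> V}.
have ml R : linear (m R).
  by move=> a y z; apply/ffunP => k; rewrite !ffunE linearP.
have actm y : act A (s y) = s (m (act V) y).
  by rewrite !sE linear_sum; apply: eq_bigr => k _; rewrite ffunE rep_homE.
exists (s \o linfun (m T) \o s^-1)%VF => x /UE[y ->].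
rewrite actm !comp_lfunE !(lker0_lfunK inj) !(linfunE (ml T)) actm -linearB.
by congr (s _); apply/ffunP => k; rewrite !ffunE -TE.
Qed.

End Copies.
End Negligible.

(** * Explicit computations in the indecomposables *)

Section Jordan.
Variables (F : fieldType) (char3 : 3%N \in [pchar F]).

Lemma act_V0 (x : V0 char3) : act (V0 char3) x = x.
Proof.
apply/rowP => j; rewrite ord1 lfunE /= !(mxE, big_ord_recl, big_ord0) /=.
by rewrite mulr1 addr0.
Qed.

Lemma act_V1 (x : V1 char3) :
  ((act (V1 char3) x : 'rV_2) 0 0 = (x : 'rV_2) 0 0) *
  ((act (V1 char3) x : 'rV_2) 0 1 = (x : 'rV_2) 0 0 + (x : 'rV_2) 0 1).
Proof.
have -> : (1 : 'I_2) = lift ord0 ord0 by exact: val_inj.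
by split; rewrite lfunE /= !(mxE, big_ord_recl, big_ord0) /=; ring.
Qed.

Lemma V1_eqP (x y : V1 char3) :
  (x : 'rV_2) 0 0 = (y : 'rV_2) 0 0 -> (x : 'rV_2) 0 1 = (y : 'rV_2) 0 1 -> x = y.
Proof.
move=> e0 e1; apply/rowP => -[[|[|//]] ltj].
  by rewrite (_ : Ordinal ltj = 0) //; apply: val_inj.
by rewrite (_ : Ordinal ltj = 1) //; apply: val_inj.
Qed.

Lemma delta_V1_delta (x : V1 char3) : delta _ (delta _ x) = 0.
Proof. by apply: V1_eqP; rewrite !deltaE !mxE !act_V1 ?mxE ?act_V1; ring. Qed.

Lemma V1_delta_ker (x : V1 char3) : delta _ x = 0 -> exists z : V1 char3, x = delta _ z.
Proof.
move=> /rowP/(_ 1); rewrite deltaE !mxE act_V1 addrK => x0.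
exists ((x : 'rV_2) 0 1 *: v0 char3); apply: V1_eqP; rewrite deltaE !mxE !act_V1 !mxE /=.
  by rewrite x0 subrr.
by ring.
Qed.

(* The Weyl relation [d/dt, t] = 1 on F[t]/(t^3), with sigma acting as 1 + t. *)
Lemma V2_commutator : exists T : 'End(V2 char3),
  forall x, x = T (act (V2 char3) x) - act (V2 char3) (T x).
Proof.
exists (linfun (mulmxr (\matrix_(i < 3, j < 3) ((j.+1 == i :> nat)%:R * (i : nat)%:R)))).
move=> x; rewrite !lfunE /=; apply/rowP.
have e3 : 1 + 1 + 1 = 0 :> F by rewrite -(pcharf0 char3) !mulrSr add0r.
move=> [[|[|[|//]]] lj]; rewrite !(mxE, big_ord_recl, big_ord0) /= /bump /=.
- rewrite (_ : Ordinal lj = ord0); last exact: val_inj.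
  by ring.
- rewrite (_ : Ordinal lj = lift ord0 ord0); last exact: val_inj.
  by ring.
- rewrite (_ : Ordinal lj = lift ord0 (lift ord0 ord0)); last exact: val_inj.
  set a := x 0 (lift ord0 (lift ord0 ord0)).
  (* Multiplication by t kills t^2, so only - t d/dt contributes at the top, with eigenvalue -2 =
     1. *)
  transitivity (a - (1 + 1 + 1) * a); last by ring.
  by rewrite e3 mul0r subr0.
Qed.

End Jordan.

(** * Coordinates on the objects F(S) *)

Section OddCoordinates.
Variables (F : fieldType) (char3 : 3%N \in [pchar F]).
Implicit Types U : vectType F.
Local Notation V1 := (V1 char3).
Local Notation v0 := (v0 char3).
Local Notation v1 := (v1 char3).

Definition odd_coord U (j : 'I_2) : 'Hom(tens U V1, U) :=
  tens_lift (fun (x : U) (s : V1) => (s : 'rV_2) 0 j *: x).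

Lemma odd_coordE U j (x : U) (s : V1) :
  odd_coord U j (tensv x s) = (s : 'rV_2) 0 j *: x.
Proof.
apply: (@tens_liftE _ _ _ _ (fun (x : U) (s : V1) => (s : 'rV_2) 0 j *: x)).
split=> [{}s|{}x] a y z; first by rewrite scalerDr !scalerA mulrC.
by rewrite !mxE scalerDl scalerA.
Qed.

Lemma tens_odd_coord U (t : tens U V1) :
  t = tensv (odd_coord U 0 t) v0 + tensv (odd_coord U 1 t) v1.
Proof.
have [h1 h2] := @tensv_bilin F U V1.
move: t; apply: tens_ext_lin => [//|a s t|x s].
  by rewrite !linearP !h1 scalerDr addrACA.
rewrite !odd_coordE.
have hZ c (v : V1) : tensv (c *: x) v = tensv x (c *: v).
  by rewrite -[c *: x]addr0 -[c *: v]addr0 h1 h2 tens0v tensv0.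
rewrite !hZ; rewrite [in LHS](_ : s = 1 *: ((s : 'rV_2) 0 0 *: v0) + (s : 'rV_2) 0 1 *: v1).
  by rewrite h2 scale1r.
by apply: V1_eqP; rewrite !mxE /=; ring.
Qed.

Lemma odd_coord_pair U (x y : U) :
  (odd_coord U 0 (tensv x v0 + tensv y v1) = x) *
  (odd_coord U 1 (tensv x v0 + tensv y v1) = y).
Proof.
by split; rewrite linearD /= !odd_coordE !mxE /= scale1r scale0r ?addr0 ?add0r.
Qed.

Lemma odd_coord_act U (t : tens U V1) :
  (odd_coord U 0 (tens_map \1 (act V1) t) = odd_coord U 0 t) *
  (odd_coord U 1 (tens_map \1 (act V1) t) = odd_coord U 0 t + odd_coord U 1 t).
Proof.
split; move: t; apply: tens_ext_lin => [a s t|a s t|x s]; rewrite ?linearP //=.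
- by rewrite tens_mapE id_lfunE !odd_coordE act_V1.
- by rewrite scalerDr addrACA.
- by rewrite tens_mapE id_lfunE !odd_coordE act_V1 scalerDl.
Qed.

Section FOb.
Variable S : svec F.
Local Notation S0 := (even_part S).
Local Notation S1 := (odd_part S).

(* Coordinates along [S0], [S1 (x) v0] and [S1 (x) v1]; the last summand is *)
(* the image of [delta].                                                    *)
Definition F_even (u : F_ob char3 S) : S0 := u.1.
Definition F_odd (u : F_ob char3 S) : S1 := odd_coord S1 0 u.2.
Definition F_delta (u : F_ob char3 S) : S1 := odd_coord S1 1 u.2.
Definition F_mk (a : S0) (x y : S1) : F_ob char3 S := (a, tensv x v0 + tensv y v1).

Arguments F_mk : simpl never.
Arguments F_even : simpl never.
Arguments F_odd : simpl never.
Arguments F_delta : simpl never.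

Lemma F_mkE a x y :
  (F_even (F_mk a x y) = a) * (F_odd (F_mk a x y) = x) *
  (F_delta (F_mk a x y) = y).
Proof. by rewrite /F_odd /F_delta /= !odd_coord_pair. Qed.

Lemma F_mkK u : F_mk (F_even u) (F_odd u) (F_delta u) = u.
Proof. by case: u => a t; rewrite /F_mk -tens_odd_coord. Qed.

Lemma F_ob_eqP u v :
  F_even u = F_even v -> F_odd u = F_odd v -> F_delta u = F_delta v -> u = v.
Proof. by move=> eE eO eD; rewrite -(F_mkK u) -(F_mkK v) eE eO eD. Qed.

Lemma F_ob_act u : (F_even (act _ u) = F_even u) * (F_odd (act _ u) = F_odd u) *
  (F_delta (act _ u) = F_odd u + F_delta u).
Proof. by rewrite /F_even /F_odd /F_delta /= pair_mapE /= id_lfunE !odd_coord_act. Qed.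

Lemma F_even_linear : linear F_even.
Proof. by []. Qed.
Lemma F_odd_linear : linear F_odd.
Proof. by move=> a u v; rewrite /F_odd /= linearP. Qed.
Lemma F_delta_linear : linear F_delta.
Proof. by move=> a u v; rewrite /F_delta /= linearP. Qed.

HB.instance Definition _ :=
  GRing.isLinear.Build F (F_ob char3 S) S0 *:%R
    F_even F_even_linear.
HB.instance Definition _ :=
  GRing.isLinear.Build F (F_ob char3 S) S1 *:%R
    F_odd F_odd_linear.
HB.instance Definition _ :=
  GRing.isLinear.Build F (F_ob char3 S) S1 *:%R
    F_delta F_delta_linear.

Lemma F_mk_linear (Z : vectType F) (a : Z -> S0) (x y : Z -> S1) :
  linear a -> linear x -> linear y -> linear (fun z => F_mk (a z) (x z) (y z)).
Proof.
by move=> la lx ly c z z'; apply: F_ob_eqP; rewrite [RHS]linearP /= !F_mkE ?la ?lx ?ly.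
Qed.

(** If T has even, odd and delta components h, m, k, then T sigma - sigma T has components h delta,
    m delta, k delta - m. Matching the last one gives m = k delta - [F_delta] f. Equivariance makes
    [F_odd] f equal to [F_delta] f delta, so the odd component becomes k delta^2 - [F_odd] f, whence
    the doubled condition. *)
Lemma F_ob_negligible (X : rep F) (f : rep_hom X (F_ob char3 S))
    (h : 'Hom(X, S0)) (k : 'Hom(X, S1)) :
  (forall t, F_even (f t) = h (delta X t)) ->
  (forall t, F_odd (f t) + F_odd (f t) = k (delta X (delta X t))) ->
  f \in negligible X (F_ob char3 S).
Proof.
move=> fh fk.
(* The [S1 (x) v1]-part of [f = T sigma - sigma T] forces the middle entry. *)
pose T t := F_mk (h t) (k (delta X t) - F_delta (f t)) (k t).
have lT : linear T.
  by apply: F_mk_linear => a s t; rewrite !linearP //= scalerDr addrACA.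
apply: (@commutator_negligible _ _ _ f (linfun T)) => t; rewrite !(linfunE lT).
apply: F_ob_eqP; rewrite linearB /= F_ob_act !F_mkE.
- by rewrite fh deltaE linearB.
- rewrite rep_homE F_ob_act -[LHS](addrK (F_odd (f t))) fk [in LHS]deltaE !linearB /=.
  have -> : delta X (act X t) = act X (delta X t) by rewrite !deltaE linearB.
  by rewrite opprK opprD [- _ + F_delta _]addrC !addrA subrK addrAC.
- by rewrite deltaE linearB /= [_ - _ - _ + _]addrAC subrK subKr.
Qed.

End FOb.

Lemma F_hom_mk (S T : svec F) (f : svec_hom S T) a x y :
  RepHom (F_hom_subproof char3 f) (F_mk a x y) =
  F_mk (hom_even f a) (hom_odd f x) (hom_odd f y).
Proof.
have E t : RepHom (F_hom_subproof char3 f) t =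
    (hom_even f t.1, tens_map (hom_odd f) (\1 : 'End(V1))%VF t.2) by exact: pair_mapE.
rewrite E /F_mk; congr (_, _); apply: etrans (linearD _ _ _) _.
by congr (_ + _); apply: etrans (tens_mapE _ _ _ _) _; rewrite id_lfunE.
Qed.

(** The difference in the even part is lambda pairing v0 with v1 antisymmetrically. *)
Lemma J_hom_tensv (S T : svec F) (u : F_ob char3 S) (v : F_ob char3 T) :
  J_hom char3 S T (tensv u v) = @F_mk (svec_tens S T)
    (tensv (F_even u) (F_even v), tensv (F_odd u) (F_delta v) - tensv (F_delta u) (F_odd v))
    (tensv (F_even u) (F_odd v), tensv (F_odd u) (F_even v))
    (tensv (F_even u) (F_delta v), tensv (F_delta u) (F_even v)).
Proof.
have [h1 h2] := J11_bilin char3 S T.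
have [k1 k2] := @tensv_bilin F (odd_part (svec_tens S T)) V1.
have [l01 l10 l00 l11] := lambdaE char3.
have hD1 t s s' : J11 (s + s') t = J11 s t + J11 s' t :> tens (odd_part S) (odd_part T).
  by have := h1 t 1 s s'; rewrite !scale1r.
have hD2 t s s' : J11 t (s + s') = J11 t s + J11 t s' :> tens (odd_part S) (odd_part T).
  by have := h2 t 1 s s'; rewrite !scale1r.
have kD (s s' : odd_part (svec_tens S T)) (w : V1) : tensv (s + s') w = tensv s w + tensv s' w.
  by have := k1 w 1 s s'; rewrite !scale1r.
rewrite J_homE /J_fun /F_mk; congr (_, _).
  rewrite [in LHS](tens_odd_coord u.2) [in LHS](tens_odd_coord v.2).
  rewrite -/(F_odd u) -/(F_odd v) -/(F_delta u) -/(F_delta v).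
  rewrite hD1 !hD2 !J11E l01 l10 l00 l11.
  by rewrite !scale0r scale1r scaleN1r add0r addr0.
rewrite [in LHS](tens_odd_coord u.2) [in LHS](tens_odd_coord v.2).
rewrite -/(F_odd u) -/(F_odd v) -/(F_delta u) -/(F_delta v).
rewrite !linearD /= !J01E !J10E addrACA -!kD.
by congr (tensv (_, _) _ + tensv (_, _) _); rewrite ?addr0 ?add0r.
Qed.

End OddCoordinates.

(** * The maps between [A] and F(S) attached to a splitting *)

(** Trivial intersection is phrased elementwise, the form in which [splitting_uniq] supplies it. *)
Lemma daddv_pi_uniq (F : fieldType) (V : vectType F) (U W : {vspace V}) :
  (forall u w, u \in U -> w \in W -> u + w = 0 -> u = 0) ->
  forall u w, u \in U -> w \in W -> daddv_pi U W (u + w) = u.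
Proof.
move=> UW0 u w Uu Ww.
have capUW : (U :&: W = 0)%VS.
  apply/eqP; rewrite -subv0; apply/subvP => v; rewrite memv_cap memv0 => /andP[Uv Wv].
  by rewrite (UW0 v (- v)) ?memvN ?subrr.
have piw : daddv_pi U W w = 0.
  have := daddv_pi_add capUW (subvP (addvSr U W) _ Ww).
  rewrite [daddv_pi W U w]daddv_pi_id // ?[(W :&: U)%VS]capvC //.
  by move=> /(canRL (addrK _)); rewrite subrr.
by rewrite linearD /= piw addr0 daddv_pi_id.
Qed.

Lemma disjoint_addv_eq0 (F : fieldType) (V : vectType F) (U W : {vspace V}) u w :
  (U :&: W = 0)%VS -> u \in U -> w \in W -> u + w = 0 -> u = 0 /\ w = 0.
Proof.
move=> cap Uu Ww uw0; have u0 : u = 0.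
  by apply/eqP; rewrite -memv0 -cap memv_cap Uu -[u]addr0 -(subrr w) addrA uw0 sub0r memvN.
by move: uw0; rewrite u0 add0r.
Qed.

Section SplittingMaps.
Variables (F : fieldType) (char3 : 3%N \in [pchar F]) (A : rep F).
Variables (A0 A1 A2 B1 : {vspace A}).
Hypothesis splitA : is_splitting char3 A0 A1 A2.
Hypothesis refineA : is_refinement A1 B1.
Local Notation d := (delta A).
Local Notation dB1 := (delta A @: B1)%VS.
Local Notation S := (ss_space A0 B1).
Local Notation U := (F_ob char3 S).

Lemma delta_A0 a : a \in A0 -> d a = 0.
Proof.
case: splitA => _ _ cA0 _ _; move: a; apply: (copies_ind cA0) => [|x y x0 y0|i y].
- exact: linear0.
- by rewrite linearD /= x0 y0 addr0.
- by rewrite -rep_hom_delta deltaE act_V0 subrr linear0.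
Qed.

Lemma delta_B1_delta x : x \in B1 -> d (d x) = 0.
Proof.
move=> xB1; have: x \in A1.
  by case: refineA => _ <-; apply: subvP (addvSl _ _) _ xB1.
case: splitA => _ _ _ cA1 _; move: {xB1} x; apply: (copies_ind cA1) => [|x y x0 y0|i y].
- by rewrite !linear0.
- by rewrite !linearD /= x0 y0 addr0.
- by rewrite -!rep_hom_delta delta_V1_delta linear0.
Qed.

Lemma splitting_uniq a x y w : a \in A0 -> x \in B1 -> y \in dB1 -> w \in A2 ->
  a + x + y + w = 0 -> [/\ a = 0, x = 0, y = 0 & w = 0].
Proof.
move=> aA0 xB1 yB1 wA2 sum0; have [dB BA1] := refineA; have [dA _ _ _ _] := splitA.
have xyA1 : x + y \in A1 by rewrite -BA1 memv_add.
move: dA; rewrite directv_addE /= => /and3P[/directv_addP cap01 _ /eqP cap2].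
have axy : a + (x + y) \in (A0 + A1)%VS by rewrite memv_add.
move: sum0; rewrite -[a + x + y]addrA => /(disjoint_addv_eq0 cap2 axy wA2)[axy0 ->].
have [-> xy0] := disjoint_addv_eq0 cap01 aA0 xyA1 axy0.
by have [-> ->] := disjoint_addv_eq0 (directv_addP dB) xB1 yB1 xy0.
Qed.

(** On copies of V1 the kernel of delta is its image, and delta([A1]) lies in delta([B1]) because
    delta^2 = 0 on [B1]. So x lies in both [B1] and delta([B1]), which meet trivially. *)
Lemma delta_B1_inj x : x \in B1 -> d x = 0 -> x = 0.
Proof.
move=> xB1 dx0; have [dirB BA1] := refineA.
have xA1 : x \in A1 by rewrite -BA1; apply: subvP (addvSl _ _) _ xB1.
have [_ _ _ cA1 _] := splitA.
have [z zA1 xE] := copies_delta_ker cA1 (@V1_delta_ker F char3) xA1 dx0.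
have xdB1 : x \in dB1.
  move: zA1; rewrite -BA1 xE => /memv_addP[u uB1 [v /memv_imgP[b bB1 ->] ->]].
  by rewrite linearD /= delta_B1_delta // addr0 memv_img.
by move/directv_addP: dirB => cap0; apply/eqP; rewrite -memv0 -cap0 memv_cap xB1.
Qed.

Lemma splitting_exists z : exists a x y w, w \in A2 /\
  z = vsval (a : subvs_of A0) + vsval (x : subvs_of B1) + d (vsval (y : subvs_of B1)) + w.
Proof.
have [_ Afull _ _ _] := splitA; have [_ BA1] := refineA.
have: z \in fullv := memvf z.
rewrite -Afull -BA1 => /memv_addP[u /memv_addP[a aA0 [v /memv_addP[x xB1 [b]]]]].
move=> /memv_imgP[y yB1 ->] -> -> [w wA2 ->].
by exists (vsproj A0 a), (vsproj B1 x), (vsproj B1 y), w; rewrite !vsprojK // !addrA.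
Qed.

Definition odd_delta : 'Hom(subvs_of B1, A) := linfun (d \o vsval).

Lemma odd_deltaE x : odd_delta x = d (vsval x).
Proof. by rewrite lfunE. Qed.

Lemma odd_delta_ker : lker odd_delta == 0%VS.
Proof.
rewrite -subv0; apply/subvP => x; rewrite memv_ker memv0 odd_deltaE => /eqP dx0.
by apply/eqP/val_inj; rewrite /= (delta_B1_inj (subvsP x) dx0).
Qed.

(** The component in delta([B1]), read back in [B1]; the inverse is genuine there by
    [odd_delta_ker]. *)
Definition ss_projD (z : A) : subvs_of B1 :=
  (odd_delta^-1)%VF (daddv_pi dB1 (A0 + B1 + A2) z).

Definition split_proj_fun (z : A) : U :=
  F_mk char3 (S := S) (ss_proj0 A0 A2 B1 z) (ss_proj1 A0 A2 B1 z) (ss_projD z).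

Lemma split_proj_funE (a : subvs_of A0) (x y : subvs_of B1) w : w \in A2 ->
  split_proj_fun (vsval a + vsval x + d (vsval y) + w) = F_mk char3 (S := S) a x y.
Proof.
move=> wA2; have [aA0 xB1 yB1] := And3 (subvsP a) (subvsP x) (subvsP y).
have dyB : d (vsval y) \in dB1 by apply: memv_img.
have uniq0 u v (uU : u \in A0) : v \in (B1 + dB1 + A2)%VS -> u + v = 0 -> u = 0.
  case/memv_addP=> _ /memv_addP[b bB [c cB ->]] [e eA ->]; rewrite !addrA => s0.
  by have [] := splitting_uniq uU bB cB eA s0.
have uniq1 u v (uU : u \in B1) : v \in (A0 + dB1 + A2)%VS -> u + v = 0 -> u = 0.
  case/memv_addP=> _ /memv_addP[b bB [c cB ->]] [e eA ->]; rewrite !addrA [u + b]addrC => s0.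
  by have [] := splitting_uniq bB uU cB eA s0.
have uniqD u v (uU : u \in dB1) : v \in (A0 + B1 + A2)%VS -> u + v = 0 -> u = 0.
  case/memv_addP=> _ /memv_addP[b bB [c cB ->]] [e eA ->]; rewrite addrA [u + _]addrC => s0.
  by have [] := splitting_uniq bB cB uU eA s0.
rewrite /split_proj_fun; congr F_mk.
- rewrite /ss_proj0 -!addrA (daddv_pi_uniq uniq0) ?addrA ?memv_add //.
  by rewrite vsvalK.
- rewrite /ss_proj1 [_ a + _]addrC -!addrA (daddv_pi_uniq uniq1) ?addrA ?memv_add //.
  by rewrite vsvalK.
- rewrite /ss_projD [_ + d _]addrC -addrA (daddv_pi_uniq uniqD) ?memv_add //.
  by rewrite -odd_deltaE lker0_lfunK ?odd_delta_ker.
Qed.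

Lemma split_proj_fun_linear : linear split_proj_fun.
Proof.
apply: F_mk_linear => a x y; rewrite ?ss_proj0_linear ?ss_proj1_linear //.
by rewrite /ss_projD !linearP.
Qed.

Definition split_incl_fun (u : U) : A :=
  vsval (F_even u) + vsval (F_odd u) + d (vsval (F_delta u)).

Lemma split_incl_fun_linear : linear split_incl_fun.
Proof.
move=> a u v; rewrite /split_incl_fun !linearP /= !scalerDr.
by rewrite [RHS]addrACA [in RHS](addrACA (a *: _)).
Qed.

Lemma split_incl_fun_act u : split_incl_fun (act _ u) = act A (split_incl_fun u).
Proof.
rewrite /split_incl_fun !F_ob_act !linearD /= !actE.
rewrite (delta_A0 (subvsP _)) (delta_B1_delta (subvsP _)) !addr0.
by rewrite !addrA.
Qed.

Lemma split_incl_subproof : linfun split_incl_fun \in equivar U A.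
Proof.
by apply: equivarP => u; rewrite !(linfunE split_incl_fun_linear) split_incl_fun_act.
Qed.
Definition split_incl : rep_hom U A := RepHom split_incl_subproof.

Lemma split_inclE u :
  split_incl u = vsval (F_even u) + vsval (F_odd u) + d (vsval (F_delta u)).
Proof. exact: (linfunE split_incl_fun_linear). Qed.

Lemma act_A2 w : w \in A2 -> act A w \in A2.
Proof. by have [_ _ _ _ cA2] := splitA; exact: (copies_act cA2). Qed.

Lemma split_proj_subproof : linfun split_proj_fun \in equivar A U.
Proof.
apply: equivarP => z; rewrite !(linfunE split_proj_fun_linear).
have [a [x [y [w [wA2 ->]]]]] := splitting_exists z.
have -> : act A (vsval a + vsval x + d (vsval y) + w) =
    vsval a + vsval x + d (vsval (x + y)) + act A w.
  rewrite !linearD /= !(actE (vsval _)) (actE (d _)) (delta_A0 (subvsP _)).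
  by rewrite (delta_B1_delta (subvsP _)) !addr0 !addrA.
rewrite !split_proj_funE ?act_A2 //.
by apply: F_ob_eqP; rewrite F_ob_act !F_mkE.
Qed.
Definition split_proj : rep_hom A U := RepHom split_proj_subproof.

Lemma split_projE z : split_proj z =
  F_mk char3 (S := S) (ss_proj0 A0 A2 B1 z) (ss_proj1 A0 A2 B1 z) (ss_projD z).
Proof. exact: (linfunE split_proj_fun_linear). Qed.

Lemma split_proj_incl u : split_proj (split_incl u) = u.
Proof.
rewrite split_inclE -[X in split_proj X]addr0 [LHS](linfunE split_proj_fun_linear).
by rewrite split_proj_funE ?mem0v // F_mkK.
Qed.

Lemma split_incl_proj_negligible :
  rep_id A - rep_comp split_incl split_proj \in negligible A A.
Proof.
have [_ _ _ _ cA2] := splitA.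
have [T TE] := V2_commutator char3; have [R RE] := copies_commutator cA2 TE.
pose e := rep_id A - rep_comp split_incl split_proj.
have eE z : e z = z - split_incl (split_proj z).
  by rewrite /= add_lfunE opp_lfunE comp_lfunE id_lfunE.
have eA2 z : e z \in A2.
  rewrite eE; have [a [x [y [w [wA2 ->]]]]] := splitting_exists z.
  rewrite [split_proj _](linfunE split_proj_fun_linear) split_proj_funE //.
  by rewrite split_inclE !F_mkE addrC addKr.
(* The image of e lies in [A2], where R sigma - sigma R is the identity; as e commutes with sigma,
   composing with e gives the commutator of R e. *)
apply: (@commutator_negligible _ _ _ e (R \o e)%VF) => z.
by rewrite !comp_lfunE rep_homE -RE.
Qed.

End SplittingMaps.

(** * Comparison of the two multiplications *)

Lemma bilin_add (F : fieldType) (U V W : vectType F) (b c : U -> V -> W) :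
  bilin b -> bilin c -> bilin (fun u v => b u v + c u v).
Proof.
move=> [b1 b2] [c1 c2]; split=> [v|u] a x y.
  by rewrite b1 c1 scalerDr addrACA.
by rewrite b2 c2 scalerDr addrACA.
Qed.

Lemma pair_lfunD (F : fieldType) (U V W : vectType F) (g : 'Hom((U * V)%type, W)) s t :
  g (s, t) = g (s, 0) + g (0, t).
Proof. by rewrite -linearD; congr (g (_, _)); rewrite /= ?addr0 ?add0r. Qed.

Lemma pair_lfunB (F : fieldType) (U V W : vectType F) (g : 'Hom((U * V)%type, W)) s t :
  g (0, s - t) = g (0, s) - g (0, t).
Proof. by rewrite -linearB; congr (g (_, _)); rewrite /= subrr. Qed.

Lemma delta_tensv (F : fieldType) (X Y : rep F) (x : X) (y : Y) :
  delta (rep_tens X Y) (tensv x y) =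
  tensv (delta X x) y + tensv x (delta Y y) + tensv (delta X x) (delta Y y).
Proof.
have [h1 h2] := @tensv_bilin F X Y.
have hDl s t z : tensv (s + t) z = tensv s z + tensv t z :> tens X Y.
  by have := h1 z 1 s t; rewrite !scale1r.
have hDr s t z : tensv z (s + t) = tensv z s + tensv z t :> tens X Y.
  by have := h2 z 1 s t; rewrite !scale1r.
rewrite [LHS]deltaE /= tens_mapE !actE hDl !hDr.
by rewrite -(addrA (tensv x y)) [tensv x y + _]addrC addrK addrCA addrA.
Qed.

HB.instance Definition _ (F : fieldType) (A : rep F) (A0 A2 B1 : {vspace A}) :=
  GRing.isLinear.Build F A (subvs_of A0) *:%R (ss_proj0 A0 A2 B1)
    (@ss_proj0_linear F A A0 A2 B1).
HB.instance Definition _ (F : fieldType) (A : rep F) (A0 A2 B1 : {vspace A}) :=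
  GRing.isLinear.Build F A (subvs_of B1) *:%R (ss_proj1 A0 A2 B1)
    (@ss_proj1_linear F A A0 A2 B1).

Lemma delta_delta_tensv (F : fieldType) (X Y : rep F) (x : X) (y : Y) :
  delta X (delta X x) = 0 -> delta Y (delta Y y) = 0 ->
  delta (rep_tens X Y) (delta (rep_tens X Y) (tensv x y)) =
  tensv (delta X x) (delta Y y) + tensv (delta X x) (delta Y y).
Proof.
move=> ddx ddy; rewrite delta_tensv !linearD /= !delta_tensv ddx ddy.
by rewrite !(tensv0, tens0v, add0r, addr0).
Qed.

Section Multiplication.
Variables (F : fieldType) (char3 : 3%N \in [pchar F]) (A : rep F).
Variables (A0 A1 A2 B1 : {vspace A}).
Hypothesis splitA : is_splitting char3 A0 A1 A2.
Hypothesis refineA : is_refinement A1 B1.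
Variable mu : rep_hom (rep_tens A A) A.
Local Notation d := (delta A).
Local Notation S := (ss_space A0 B1).
Local Notation U := (F_ob char3 S).
Local Notation p := (split_proj splitA refineA).
Local Notation i := (split_incl splitA refineA).
Local Notation P0 := (ss_proj0 A0 A2 B1).
Local Notation P1 := (ss_proj1 A0 A2 B1).
Local Notation "x ** y" := (mu (tensv x y)) (at level 40).

Lemma F_ob_delta (u : U) :
  (F_even (delta _ u) = 0) * (F_odd (delta _ u) = 0) * (F_delta (delta _ u) = F_odd u).
Proof. by rewrite !deltaE !linearB /= !F_ob_act !subrr addrK. Qed.

Lemma F_ob_delta_delta (u : U) : delta U (delta U u) = 0.
Proof. by apply: F_ob_eqP; rewrite !F_ob_delta linear0. Qed.

Lemma ss_proj0E z : P0 z = F_even (p z). Proof. by rewrite split_projE F_mkE. Qed.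
Lemma ss_proj1E z : P1 z = F_odd (p z). Proof. by rewrite split_projE F_mkE. Qed.

Lemma ss_proj0_delta z : P0 (d z) = 0.
Proof. by rewrite ss_proj0E rep_hom_delta F_ob_delta. Qed.

Lemma ss_proj1_delta z : P1 (d z) = 0.
Proof. by rewrite ss_proj1E rep_hom_delta F_ob_delta. Qed.

(** In F(S) the odd coordinate of u is the delta-coordinate of delta u. *)
Lemma ss_proj1_invariant z : d z = 0 -> P1 z = 0.
Proof.
by move=> dz; rewrite ss_proj1E -(F_ob_delta (p z)).2 -rep_hom_delta dz !linear0.
Qed.

Lemma muDl x y z : (x + y) ** z = x ** z + y ** z.
Proof.
rewrite -linearD; congr (mu _); have [h1 _] := @tensv_bilin F A A.
by have := h1 z 1 x y; rewrite !scale1r.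
Qed.

Lemma muDr x y z : z ** (x + y) = z ** x + z ** y.
Proof.
rewrite -linearD; congr (mu _); have [_ h2] := @tensv_bilin F A A.
by have := h2 z 1 x y; rewrite !scale1r.
Qed.

Lemma mu0l z : 0 ** z = 0. Proof. by rewrite tens0v linear0. Qed.
Lemma mu0r z : z ** 0 = 0. Proof. by rewrite tensv0 linear0. Qed.

Lemma delta_mul x y : d (x ** y) = d x ** y + x ** d y + d x ** d y.
Proof. by rewrite -rep_hom_delta delta_tensv !linearD. Qed.

Lemma delta_mul_delta x y : d (d y) = 0 -> d (x ** d y) = d x ** d y.
Proof. by move=> ddy; rewrite delta_mul ddy !mu0r !addr0. Qed.

(** Integration by parts: [P0] kills delta(x y), and the quadratic term delta x delta y is itself
    delta(x delta y). *)
Lemma ss_proj0_skew x y : d (d y) = 0 -> P0 (d x ** y) = - P0 (x ** d y).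
Proof.
move=> ddy; apply/eqP; rewrite -addr_eq0; apply/eqP.
have := ss_proj0_delta (x ** y); rewrite delta_mul linearD /= -(delta_mul_delta x ddy).
by rewrite ss_proj0_delta addr0 linearD.
Qed.

(** [P1] z is the delta-coordinate of p(delta z). Here delta(x delta y) = delta x delta y, and twice
    this is delta^2(x y), whose delta-coordinate is [P1] (delta(x y)) = 0. *)
Lemma ss_proj1_mul_delta x y : d (d x) = 0 -> d (d y) = 0 -> P1 (x ** d y) = 0.
Proof.
move=> ddx ddy; set v := P1 _.
have projD z : P1 z = F_delta (p (d z)) by rewrite rep_hom_delta F_ob_delta -ss_proj1E.
have vv0 : v + v = 0.
  rewrite /v projD delta_mul_delta //.
  have -> z : F_delta (p z) + F_delta (p z) = F_delta (p (z + z)) by rewrite !linearD.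
  have -> : d x ** d y + d x ** d y = d (d (x ** y)).
    rewrite delta_mul !linearD /= !delta_mul ddx ddy.
    by rewrite !(mu0l, mu0r, linear0, add0r, addr0).
  by rewrite -projD ss_proj1_delta.
have e3 : 1 + 1 + 1 = 0 :> F by rewrite -(pcharf0 char3) !mulrSr add0r.
(* Since 2v = 0, v equals 3v, which is zero. *)
by rewrite -[LHS]add0r -{1}vv0 -[v]scale1r -!scalerDl e3 scale0r.
Qed.

Lemma ss_proj1_delta_mul x y : d (d x) = 0 -> d (d y) = 0 -> P1 (d x ** y) = 0.
Proof.
move=> ddx ddy; have := ss_proj1_delta (x ** y).
by rewrite delta_mul !linearD /= !ss_proj1_mul_delta ?ddx ?linear0 // !addr0.
Qed.

Section Products.
Variables a b x0 y0 x1 y1 : A.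
Hypotheses (da : d a = 0) (db : d b = 0).
Hypotheses (dx0 : d (d x0) = 0) (dy0 : d (d y0) = 0).
Hypotheses (dx1 : d (d x1) = 0) (dy1 : d (d y1) = 0).

Lemma ss_proj0_mul : P0 ((a + x0 + d x1) ** (b + y0 + d y1)) =
  P0 (a ** b) + P0 (a ** y0) +
  (P0 (x0 ** b) + P0 (x0 ** y0) + P0 (x0 ** d y1)) - P0 (x1 ** d y0).
Proof.
rewrite !muDl !muDr !linearD /= -(ss_proj0_skew _ dy0).
have -> : P0 (a ** d y1) = 0.
  by apply: oppr_inj; rewrite -ss_proj0_skew // da mu0l linear0 oppr0.
have -> : P0 (d x1 ** b) = 0.
  by rewrite (ss_proj0_skew x1) db ?linear0 // mu0r linear0 oppr0.
have -> : P0 (d x1 ** d y1) = 0 by rewrite -delta_mul_delta // ss_proj0_delta.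
by rewrite !(add0r, addr0).
Qed.

Lemma ss_proj1_mul : P1 ((a + x0 + d x1) ** (b + y0 + d y1)) =
  P1 (a ** y0) + (P1 (x0 ** b) + P1 (x0 ** y0)).
Proof.
rewrite !muDl !muDr !linearD /=.
have -> : P1 (a ** b) = 0.
  by apply: ss_proj1_invariant; rewrite delta_mul da db !(mu0l, mu0r, addr0).
rewrite !ss_proj1_mul_delta ?da ?dx1 ?linear0 //.
rewrite !ss_proj1_delta_mul ?db ?linear0 //.
by rewrite !(add0r, addr0).
Qed.
End Products.

Lemma split_incl_mul_negligible :
  rep_comp p (rep_comp mu (rep_tens_hom i i)) -
    rep_comp (RepHom (F_hom_subproof char3 (ss_mul A0 A2 B1 mu))) (J_hom char3 S S)
  \in negligible (rep_tens U U) U.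
Proof.
pose a (u : U) : A := vsval (F_even u); pose x (u : U) : A := vsval (F_odd u).
pose y (u : U) : A := vsval (F_delta u).
have la : linear a by move=> c u v; rewrite /a linearP.
have lx : linear x by move=> c u v; rewrite /x linearP.
have ly : linear y by move=> c u v; rewrite /y linearP.
have b0 := ss_mul_bilin mu (@ss_proj0_linear F A A0 A2 B1).
have bh := bilin_add (b0 _ _ _ _ ly la) (bilin_add (b0 _ _ _ _ la ly) (b0 _ _ _ _ lx ly)).
have bk := ss_mul_bilin mu (@ss_proj1_linear F A A0 A2 B1) ly ly.
have xd u : x (delta _ u) = 0 by rewrite /x F_ob_delta.
have ad u : a (delta _ u) = 0 by rewrite /a F_ob_delta.
have yd u : y (delta _ u) = x u by rewrite /y F_ob_delta.
have da u : d (a u) = 0 := delta_A0 splitA (subvsP _).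
have dx u : d (d (x u)) = 0 := delta_B1_delta splitA refineA (subvsP _).
have dy u : d (d (y u)) = 0 := delta_B1_delta splitA refineA (subvsP _).
set f := _ - _.
(* These are the two coordinates that [F_ob_negligible] asks for. *)
have fE u v :
    (F_even (f (tensv u v)) =
      P0 (a u ** x v) + (P0 (x u ** a v) + P0 (x u ** x v))) *
    (F_odd (f (tensv u v)) = P1 (x u ** x v)).
  have -> : f (tensv u v) = p (i u ** i v) - F_mk char3 (S := S)
      (P0 (a u ** a v) + (P0 (x u ** d (y v)) - P0 (y u ** d (x v))))
      (P1 (a u ** x v) + P1 (x u ** a v)) (P1 (a u ** y v) + P1 (y u ** a v)).
    rewrite [LHS]add_lfunE opp_lfunE !comp_lfunE.
    congr (_ - _).
      by congr (p (mu _)); exact: tens_mapE.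
    apply: etrans (congr1 _ (J_hom_tensv _ _)) _; etransitivity; first exact: F_hom_mk.
    congr F_mk.
    - by rewrite pair_lfunD pair_lfunB ss_mul00 !ss_mul11.
    - by rewrite pair_lfunD ss_mul01 ss_mul10.
    - by rewrite pair_lfunD ss_mul01 ss_mul10.
  split.
    rewrite [LHS](linearB (@F_even F char3 S)) [X in _ - X]F_mkE -[X in X - _]ss_proj0E.
    rewrite !split_inclE -!/(a _) -!/(x _) -!/(y _).
    by rewrite ss_proj0_mul //; apply/eqP; rewrite subr_eq [eqbRHS]addrCA -!addrA.
  rewrite [LHS](linearB (@F_odd F char3 S)) [X in _ - X]F_mkE -[X in X - _]ss_proj1E.
  rewrite !split_inclE -!/(a _) -!/(x _) -!/(y _).
  by rewrite ss_proj1_mul // addrA [_ - _]addrC addKr.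
(* On F(S), delta kills a and x and sends y to x. So h replaces one x by y in each even term, and k
   replaces both in the odd one, delta^2(u (x) v) being 2 delta u (x) delta v. *)
apply: (@F_ob_negligible _ _ _ _ f
  (tens_lift (fun u v => P0 (y u ** a v) + (P0 (a u ** y v) + P0 (x u ** y v))))
  (tens_lift (fun u v => P1 (y u ** y v)))) => t.
  move: t; apply: tens_ext_lin => [c s t|c s t|u v]; rewrite ?linearP //.
  rewrite delta_tensv !linearD /= !(tens_liftE bh) fE !xd !ad !yd.
  by rewrite !(mu0l, mu0r, linear0, add0r, addr0) addrCA.
move: t; apply: tens_ext_lin => [c s t|c s t|u v]; rewrite ?linearP //.
  by rewrite scalerDr addrACA.
by rewrite fE delta_delta_tensv ?F_ob_delta_delta // linearD /= (tens_liftE bk) !yd.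
Qed.

End Multiplication.

(** * The isomorphism of algebras in Ver_3 *)

Theorem corollary2p8 (F : fieldType) (char3 : 3%N \in [pchar F])
  (A : rep F) (mu : rep_hom (rep_tens A A) A)
  (A0 A1 A2 B1 : {vspace A}) :
  is_splitting char3 A0 A1 A2 ->
  is_refinement A1 B1 ->
  ver_alg_isomorphic
    (VerAlg (ver_class mu))
    (VerAlg
      (ver_comp (F_hom char3 (ss_mul A0 A2 B1 mu))
        (J char3 (ss_space A0 B1) (ss_space A0 B1)))).
Proof.
move=> splitA refineA; pose p := split_proj splitA refineA; pose i := split_incl splitA refineA.
have pi1 : ver_comp (ver_class p) (ver_class i) = ver_id _.
  rewrite ver_compE; congr ver_class; apply/val_inj/lfunP => u.
  by apply: etrans (comp_lfunE _ _ _) _; rewrite id_lfunE; exact: split_proj_incl.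
have ip1 : ver_comp (ver_class i) (ver_class p) = ver_id A.
  by rewrite ver_compE; apply/esym/ver_classP; exact: split_incl_proj_negligible.
exists (ver_class p); split.
  by exists (ver_class i).
have /ver_classP := split_incl_mul_negligible splitA refineA mu.
rewrite -/p -/i => mulE; rewrite /= /F_hom /J ver_tensE !ver_compE.
(* Inserting this identity before mu rewrites p mu as p mu (i (x) i) composed with p (x) p, to which
   [mulE] applies. *)
have tens_ip : ver_class (rep_tens_hom (rep_comp i p) (rep_comp i p)) = ver_id (rep_tens A A).
  rewrite -ver_tensE -ver_compE ip1 ver_tensE; congr ver_class.
  by apply/val_inj; exact: tens_map1.
transitivity (ver_comp (ver_class (rep_comp p mu)) (ver_id (rep_tens A A))).
  by rewrite ver_compE; congr ver_class; apply/val_inj; rewrite /= comp_lfun1r.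
rewrite -tens_ip ver_compE.
have -> : rep_comp (rep_comp p mu) (rep_tens_hom (rep_comp i p) (rep_comp i p)) =
    rep_comp (rep_comp p (rep_comp mu (rep_tens_hom i i))) (rep_tens_hom p p).
  by apply/val_inj; rewrite /= tens_map_comp !comp_lfunA.
by rewrite -ver_compE mulE ver_compE.
Qed.
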